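(* Let $M$ be an oriented matroid on a finite set $E$. Let $\sigma$ and $\sigma^*$ be the signatures of a generic lifting and of a generic extension of $M$, respectively. For a basis $B$ of $M$, let $O(B)$ be the reorientation of $M$ such that each $e\in E\setminus B$ is reoriented if (and only if) it is negative in $\sigma(C(B;e))$, and each $e\in B$ is reoriented if (and only if) it is negative in $\sigma^*(C^*(B;e))$. Then the map $B\mapsto O(B)$ is a bijection between the set of bases of $M$ and the set of $(\sigma^*,\sigma)$-compatible reorientations of $M$. Equivalently, this bijection can be defined, written in the inverse direction, as follows. Let $\overline{M}$ be a compliant generic extension-lifting of $M$ with respect to $(f,g)$ given by the signatures $(\sigma^*,\sigma)$, choose any linear ordering of $E\cup\{f,g\}$ in which $g$ is the smallest element and $f$ is the second smallest, and let $\alpha$ denote the fully optimal basis of a bounded ordered oriented matroid. Then the map $$-_AM\mapsto \alpha\bigl(-_{\{f,g\}}(-_A\overline{M})\bigr)\setminus\{g\}$$ is a bijection between the set of $(\sigma^*,\sigma)$-compatible reorientations of $M$ and the set of bases of $M$, and it is the inverse of $B\mapsto O(B)$.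
   Context: All oriented matroids are on finite ground sets. An extension of an oriented matroid $N$ on $S$ with respect to $f\notin S$ is an oriented matroid $\overline{N}$ on $S\cup\{f\}$ with $\overline{N}\setminus f=N$ (deletion); it is generic if every circuit of $\overline{N}$ containing $f$ is spanning, that is, the supports of circuits of $\overline{N}$ containing $f$ are exactly the sets $B\cup\{f\}$ with $B$ a basis of $N$. A lifting of $N$ with respect to $g\notin S$ is an oriented matroid $\overline{N}$ on $S\cup\{g\}$ with $\overline{N}/g=N$ (contraction); it is generic if the supports of cocircuits of $\overline{N}$ containing $g$ are exactly the sets $(S\setminus B)\cup\{g\}$ with $B$ a basis of $N$. Signatures. In a generic extension $N'$ of $M$ with respect to $f$, cocircuits $D$ of $M$ correspond bijectively to cocircuits of $N'$ containing $f$ (the one with support $D\cup\{f\}$, restricting to $D$). For an unsigned cocircuit $D$ of $M$, $\sigma^*(D)$ is the signed cocircuit of $M$ with support $D$ whose corresponding cocircuit in $N'$ has a positive sign on $f$; $\sigma^*$ is the signature of the extension. In a generic lifting $N''$ of $M$ with respect to $g$, circuits $C$ of $M$ correspond bijectively to circuits of $N''$ containing $g$ (with support $C\cup\{g\}$, restricting to $C$). For an unsigned circuit $C$ of $M$, $\sigma(C)$ is the signed circuit of $M$ with support $C$ whose corresponding circuit in $N''$ has a positive sign on $g$; $\sigma$ is the signature of the lifting. In $\sigma(C(B;e))$ and $\sigma^*(C^*(B;e))$ only the supports of the fundamental (co)circuits are used. For a basis $B$ of an oriented matroid: for $b\in B$, $C^*(B;b)$ is the fundamental cocircuit, i.e.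 the signed cocircuit whose support is the complement of the closure of $B\setminus\{b\}$, with positive sign on $b$; for $e\notin B$, $C(B;e)$ is the fundamental circuit, i.e. the signed circuit with support contained in $B\cup\{e\}$, with positive sign on $e$. Reorientations. $-_AN$ denotes the oriented matroid obtained from $N$ by reorienting the elements of $A$; reorientations of $N$ are indexed by subsets $A$ of the ground set (counted as distinct for distinct $A$, even if the resulting oriented matroids coincide). Acyclic means no positive circuit; totally cyclic means no positive cocircuit. Compatibility. Let $N'$ be the generic extension of $M$ with respect to $f$ with signature $\sigma^*$ and $N''$ the generic lifting of $M$ with respect to $g$ with signature $\sigma$. A reorientation $-_AM$, $A\subseteq E$, is $(\sigma^*,\sigma)$-compatible if: for every positive cocircuit $D$ of $-_AM$, the corresponding cocircuit (with support $D\cup\{f\}$) of $-_AN'$ has a positive sign on $f$ (equivalently, $-_{\{f\}}(-_AN')$ is totally cyclic); and for every positive circuit $C$ of $-_AM$, the corresponding circuit (with support $C\cup\{g\}$) of $-_AN''$ has a positive sign on $g$ (equivalently, $-_{\{g\}}(-_AN'')$ is acyclic). Extension-liftings. Let $f\ne g$ be elements not in $E$. A generic extension-lifting of $M$ with respect to $(f,g)$ is an oriented matroid $\overline{M}$ on $E\cup\{f,g\}$ such that $(\overline{M}/g)\setminus f=M$, $\overline{M}$ is a generic extension of $\overline{M}\setminus f$ with respect to $f$, and $\overline{M}$ is a generic lifting of $\overline{M}/g$ with respect to $g$ ($f$ and $g$ are not loops nor coloops of $\overline{M}$). It is given by the signatures $(\sigma^*,\sigma)$ if $\overline{M}/g$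 is the extension of $M$ with signature $\sigma^*$ and $\overline{M}\setminus f$ is the lifting of $M$ with signature $\sigma$. It is compliant if no signed cocircuit of $\overline{M}$ is positive on $g$ and negative on $f$ (such a compliant $\overline{M}$ always exists for given $\sigma^*,\sigma$). Fully optimal bases. Let $N$ be an oriented matroid on a linearly ordered set $S$ with smallest element $g$. A basis $B$ of $N$ is fully optimal if (a) for every $e\in S\setminus B$, the signs in $C(B;e)$ of $e$ and of $\min(C(B;e))$ are opposite, and (b) for every $b\in B\setminus\{g\}$, the signs in $C^*(B;b)$ of $b$ and of $\min(C^*(B;b))$ are opposite (the minima are taken over supports). $N$ is bounded (with respect to $g$) if it is acyclic and every positive cocircuit contains $g$; it is known (Gioan–Las Vergnas) that then $N$ has exactly one fully optimal basis, denoted $\alpha(N)$. *)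

(* Defs.v *)
From mathcomp Require Import all_boot.

Set Implicit Arguments.
Unset Strict Implicit.
Unset Printing Implicit Defensive.

(* All ground sets are subsets of an ambient finite type T, so that extensions
   and liftings by new elements live in the same type. *)

Section SignedSets.
Variable T : finType.

(* A signed set X is the pair (X^+, X^-). Disjointness of the two parts is
   required where signed sets occur: in the axioms for circuits and in the
   definition of cocircuits. *)
Definition signed := ({set T} * {set T})%type.

Implicit Types (X Y : signed) (x y : T) (A : {set T}).

Definition supp X : {set T} := X.1 :|: X.2.
Definition szero : signed := (set0, set0).
Definition sopp X : signed := (X.2, X.1).
Definition srem x X : signed := (X.1 :\ x, X.2 :\ x).
Definition sreorient A X : signed :=
  ((X.1 :\: A) :|: (X.2 :&: A), (X.2 :\: A) :|: (X.1 :&: A)).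
Definition spositive X : bool := X.2 == set0.

Definition opposite_in X x y : bool :=
  ((x \in X.1) && (y \in X.2)) || ((x \in X.2) && (y \in X.1)).

(* X and Y agree on some common element iff they disagree on some common
   element. *)
Definition orthogonal X Y : bool :=
  ((X.1 :&: Y.1) :|: (X.2 :&: Y.2) == set0) ==
  ((X.1 :&: Y.2) :|: (X.2 :&: Y.1) == set0).

End SignedSets.

Section OrientedMatroids.
Variable T : finType.

Record omdata := OMData { ground : {set T}; circuits : {set signed T} }.

Implicit Types (N M : omdata) (A B C D : {set T}) (X Y Z : signed T) (x : T).

Record oriented_matroid N : Prop := OrientedMatroid {
  om_signed : forall X, X \in circuits N ->
    supp X \subset ground N /\ [disjoint X.1 & X.2];
  om_nonzero : szero T \notin circuits N;
  om_opp : forall X, X \in circuits N -> sopp X \in circuits N;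
  om_incomparable : forall X Y, X \in circuits N -> Y \in circuits N ->
    supp X \subset supp Y -> X = Y \/ X = sopp Y;
  om_elimination : forall X Y e, X \in circuits N -> Y \in circuits N ->
    X <> sopp Y -> e \in X.1 :&: Y.2 ->
    exists2 Z, Z \in circuits N &
      (Z.1 \subset (X.1 :|: Y.1) :\ e) /\ (Z.2 \subset (X.2 :|: Y.2) :\ e) }.

Definition independent N A : bool :=
  (A \subset ground N) && [forall X in circuits N, ~~ (supp X \subset A)].

Definition bases N : {set {set T}} := [set B | maxset (independent N) B].

Definition closure N A : {set T} :=
  A :|: [set e in ground N |
          [exists X in circuits N, (e \in supp X) && (supp X \subset e |: A)]].

(* The supports are the cocircuits of the underlying matroid, i.e. the minimal
   sets meeting every basis. *)
Definition cocircuits N : {set signed T} :=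
  [set X : signed T | [&& [disjoint X.1 & X.2],
    minset (fun D : {set T} => [forall B in bases N, D :&: B != set0]) (supp X) &
    [forall Y in circuits N, orthogonal X Y]]].

Definition acyclic N : bool := [forall X in circuits N, ~~ spositive X].

Definition loop N x : bool := [exists X in circuits N, supp X == [set x]].
Definition coloop N x : bool := [exists X in cocircuits N, supp X == [set x]].

Definition delete N x : omdata :=
  OMData (ground N :\ x) [set X in circuits N | x \notin supp X].

Definition contract N x : omdata :=
  let F := [set srem x X | X in circuits N] in
  OMData (ground N :\ x)
    [set X in F |
      minset (fun S : {set T} => (S != set0) && (S \in [set supp Y | Y in F])) (supp X)].

Definition reorient A N : omdata :=
  OMData (ground N) [set sreorient A X | X in circuits N].

(* The default value szero is never reached when B is a basis of N, and
   e \in ground N :\: B (resp. b \in B). *)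
Definition fund_circuit N B e : signed T :=
  odflt (szero T)
    [pick X in circuits N | (supp X \subset e |: B) && (e \in X.1)].

Definition fund_cocircuit N B b : signed T :=
  odflt (szero T)
    [pick X in cocircuits N |
      (supp X == ground N :\: closure N (B :\ b)) && (b \in X.1)].

Definition generic_extension M N f : Prop :=
  [/\ f \notin ground M, oriented_matroid N, ground N = f |: ground M,
      delete N f = M &
      [set supp X | X in circuits N & f \in supp X] =
      [set f |: B | B in bases M]].

Definition generic_lifting M N g : Prop :=
  [/\ g \notin ground M, oriented_matroid N, ground N = g |: ground M,
      contract N g = M &
      [set supp X | X in cocircuits N & g \in supp X] =
      [set g |: (ground M :\: B) | B in bases M]].

(* For F the signed (co)circuits of M and F' those of an extension or lifting
   of M by x: the member X of F with support S such that the member of F'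
   containing x and restricting to X is positive on x. *)
Definition signature (F F' : {set signed T}) x S : signed T :=
  odflt (szero T)
    [pick X in F | (supp X == S) &&
      [exists Y in F', (srem x Y == X) && (x \in Y.1)]].

Definition extension_signature M N f : {set T} -> signed T :=
  signature (cocircuits M) (cocircuits N) f.

Definition lifting_signature M N g : {set T} -> signed T :=
  signature (circuits M) (circuits N) g.

Definition positive_on_new (F F' : {set signed T}) x : bool :=
  [forall X in F, spositive X ==>
    [forall Y in F', (x \in supp Y) && (srem x Y == X) ==> (x \in Y.1)]].

(* Reorientations of M are represented by the set A of reoriented elements;
   N' is the extension of M by f, and N'' the lifting of M by g. *)
Definition compatible M N' f N'' g A : bool :=
  positive_on_new (cocircuits (reorient A M)) (cocircuits (reorient A N')) f &&
  positive_on_new (circuits (reorient A M)) (circuits (reorient A N'')) g.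

Definition compatible_reorientations M N' f N'' g : {set {set T}} :=
  [set A in powerset (ground M) | compatible M N' f N'' g A].

Definition orientation_of_basis M (sigmas sigma : {set T} -> signed T) B :
    {set T} :=
  [set e in ground M |
    if e \in B then e \in (sigmas (supp (fund_cocircuit M B e))).2
    else e \in (sigma (supp (fund_circuit M B e))).2].

Definition generic_extension_lifting M N f g : Prop :=
  [/\ [/\ f != g, f \notin ground M & g \notin ground M],
      oriented_matroid N /\ ground N = f |: (g |: ground M),
      delete (contract N g) f = M,
      generic_extension (delete N f) N f /\
        generic_lifting (contract N g) N g &
      [/\ ~~ loop N f, ~~ coloop N f, ~~ loop N g & ~~ coloop N g]].

Definition given_by_signatures M N f g (sigmas sigma : {set T} -> signed T) :
    Prop :=
  [/\ generic_extension M (contract N g) f,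
      {in [set supp X | X in cocircuits M],
        extension_signature M (contract N g) f =1 sigmas},
      generic_lifting M (delete N f) g &
      {in [set supp X | X in circuits M],
        lifting_signature M (delete N f) g =1 sigma}].

Definition compliant N f g : Prop :=
  forall X, X \in cocircuits N -> ~~ ((g \in X.1) && (f \in X.2)).

Definition linear_order_on A (le : rel T) : Prop :=
  [/\ {in A &, antisymmetric le}, {in A & &, transitive le} &
      {in A &, total le}].

Definition is_min (le : rel T) A x : bool :=
  (x \in A) && [forall y in A, le x y].

Definition opposite_to_min (le : rel T) X e : bool :=
  [exists m, is_min le (supp X) m && opposite_in X e m].

Definition fully_optimal N g (le : rel T) B : bool :=
  [&& B \in bases N,
      [forall e in ground N :\: B, opposite_to_min le (fund_circuit N B e) e] &
      [forall b in B :\ g, opposite_to_min le (fund_cocircuit N B b) b]].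

Definition bounded N g : bool :=
  acyclic N && [forall X in cocircuits N, spositive X ==> (g \in supp X)].

(* The fully optimal basis of N, which exists and is unique if N is bounded
   with respect to its smallest element g. *)
Definition alpha N g (le : rel T) : {set T} :=
  odflt set0 [pick B | fully_optimal N g le B].

End OrientedMatroids.

Definition bijection_between (aT rT : finType) (A : {set aT}) (B : {set rT})
    (h : aT -> rT) : Prop :=
  {in A &, injective h} /\ [set h x | x in A] = B.

(* Main.v *)
Require Import Defs.
From mathcomp Require Import all_boot.

(** Write E for the ground set of M and O(B) for the reorientation of the basis B.

    A basis B is recorded by two signed sets: after reorienting along O(B), the
    circuit of N' on B + f is positive on B and negative on f, and the cocircuit of
    N'' on (E - B) + g is positive on E - B and negative on g
    ([orientation_circuit], [orientation_cocircuit]). Orthogonality with these two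
    makes O(B) compatible ([orientation_compatible]). It also makes O injective
    ([orientation_inj]): if O(B1) = O(B2), eliminating f between the circuits of B1
    and B2 gives a circuit of M whose lift to N'' would be both positive and
    negative on g.

    Surjectivity is a count: there are at most as many compatible reorientations
    as bases ([states_le_bases]). Compatibility makes sense for every minor of M;
    here it is expressed inside M by remembering a deleted set X and a contracted
    set Y. Let e be an element outside X and Y. If a reorientation is compatible,
    it stays so after deleting e or after contracting e: a cocircuit obstructing
    the deletion and a circuit obstructing the contraction would both be negative
    on e and positive on the other common elements, against orthogonality. If it
    is compatible with both signs of e, it stays so after both. When all elements
    are used up, compatibility says that Y contains no circuit and meets every
    cocircuit, so that Y is a basis. Hence the number of compatible reorientations
    satisfies the recurrence of the number of bases, as an inequality.

    Let now N be a compliant extension-lifting. As only signatures matter, N' and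
    N'' may be replaced by N / g and N - f. For a basis B of M and the basis B + g
    of N, the smallest element of a fundamental circuit is g, and the smallest
    element of the fundamental cocircuit of b in B is f. So full optimality of
    B + g, in N reoriented along A and {f, g}, compares at each element of E the
    sign that defines O(B) with membership in A, and at f it is automatic by
    compliance: B + g is fully optimal exactly when A = O(B)
    ([fully_optimal_orientation]). Every fully optimal basis contains g and not f
    ([fully_optimal_basis]), so it has this form, and uniqueness follows from the
    injectivity of O.

    All this rests on the existence of signed fundamental cocircuits
    ([fund_cocircuit_exists]), deduced here from weak circuit elimination. *)

Set Implicit Arguments.
Unset Strict Implicit.
Unset Printing Implicit Defensive.

(** * Signed sets *)

Section SignedSetTheory.
Variable T : finType.
Implicit Types (X Y Z D : signed T) (x y : T) (A B S : {set T}).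

Lemma in_supp X x : (x \in supp X) = (x \in X.1) || (x \in X.2).
Proof. by rewrite inE. Qed.

Lemma supp_opp X : supp (sopp X) = supp X.
Proof. exact: setUC. Qed.

Lemma soppK X : sopp (sopp X) = X.
Proof. by case: X. Qed.

Lemma disjoint_opp X : [disjoint (sopp X).1 & (sopp X).2] = [disjoint X.1 & X.2].
Proof. by rewrite disjoint_sym. Qed.

Lemma supp_srem x X : supp (srem x X) = supp X :\ x.
Proof. by rewrite /supp /= -setDUl. Qed.

Lemma srem_opp x X : srem x (sopp X) = sopp (srem x X).
Proof. by []. Qed.

Lemma in_sreorient A X x :
  ((x \in (sreorient A X).1) = if x \in A then x \in X.2 else x \in X.1) *
  ((x \in (sreorient A X).2) = if x \in A then x \in X.1 else x \in X.2).
Proof.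
by split; rewrite /sreorient /= !in_setU !in_setD !in_setI;
  case: (x \in A); rewrite /= ?andbT ?andbF ?orbF.
Qed.

Lemma signed_eq X Y : X.1 =i Y.1 -> X.2 =i Y.2 -> X = Y.
Proof. by case: X Y => [X1 X2] [Y1 Y2] /= /setP -> /setP ->. Qed.

Lemma sreorientK A : involutive (@sreorient T A).
Proof. by move=> X; apply: signed_eq => x; rewrite !in_sreorient; case: (x \in A). Qed.

Lemma supp_reorient A X : supp (sreorient A X) = supp X.
Proof.
by apply/setP=> x; rewrite !in_supp !in_sreorient; case: ifP => // _; rewrite orbC.
Qed.

Lemma sreorient_opp A X : sreorient A (sopp X) = sopp (sreorient A X).
Proof. by apply: signed_eq => x; rewrite !in_sreorient. Qed.

Lemma sreorient_srem A x X : sreorient A (srem x X) = srem x (sreorient A X).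
Proof.
by apply: signed_eq => y; rewrite !in_sreorient !in_setD1 !in_sreorient; case: (y \in A).
Qed.

Lemma sreorientD A A' X : [disjoint A & A'] ->
  sreorient A (sreorient A' X) = sreorient (A :|: A') X.
Proof.
move=> dAA'; apply: signed_eq => x; rewrite !in_sreorient inE.
  by case: ifP => // xA; rewrite (disjointFr dAA').
by case: ifP => // xA; rewrite (disjointFr dAA').
Qed.

Lemma disjoint_reorient A X :
  [disjoint X.1 & X.2] -> [disjoint (sreorient A X).1 & (sreorient A X).2].
Proof.
move=> dX; apply/pred0P=> x /=; rewrite !in_sreorient.
by case: ifP; have := disjointFr dX (x := x); case: (_ \in X.1) => [->|]; rewrite ?andbF.
Qed.

(** Disagreement at [x] is written [agree X (sopp Y) x], so that the lemmas on
    agreement serve for disagreement as well. *)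
Definition agree X Y x :=
  (x \in X.1) && (x \in Y.1) || (x \in X.2) && (x \in Y.2).

Lemma agree_supp X Y x : agree X Y x -> (x \in supp X) && (x \in supp Y).
Proof. by rewrite !in_supp => /orP[]/andP[-> ->]; rewrite ?orbT. Qed.

Lemma agree_or X Y x :
  x \in supp X -> x \in supp Y -> agree X Y x || agree X (sopp Y) x.
Proof. by rewrite /agree !in_supp /= => /orP[->|->] /orP[->|->]; rewrite ?orbT. Qed.

Lemma agree_not X Y x : [disjoint X.1 & X.2] -> [disjoint Y.1 & Y.2] ->
  agree X Y x -> agree X (sopp Y) x = false.
Proof.
move=> dX dY /orP[]/andP[xX xY]; rewrite /agree /=.
  by rewrite (disjointFr dX xX) (disjointFr dY xY) andbF.
by rewrite (disjointFl dX xX) (disjointFl dY xY) andbF.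
Qed.

Lemma agree_eq X Y x : [disjoint X.1 & X.2] -> [disjoint Y.1 & Y.2] ->
  agree X Y x -> ((x \in X.1) = (x \in Y.1)) * ((x \in X.2) = (x \in Y.2)).
Proof.
move=> dX dY /orP[]/andP[xX xY]; rewrite xX xY.
  by rewrite (disjointFr dX xX) (disjointFr dY xY).
by rewrite (disjointFl dX xX) (disjointFl dY xY).
Qed.

Lemma agree_sym X Y x : agree X Y x = agree Y X x.
Proof. by rewrite /agree ![(_ \in X.1) && _]andbC ![(_ \in X.2) && _]andbC. Qed.

Lemma agree_opp X Y x : agree (sopp X) (sopp Y) x = agree X Y x.
Proof. by rewrite /agree orbC. Qed.

Lemma agree_oppl X Y x : agree (sopp X) Y x = agree X (sopp Y) x.
Proof. by rewrite -agree_opp soppK. Qed.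

Lemma agree_reorient A X Y x :
  agree (sreorient A X) (sreorient A Y) x = agree X Y x.
Proof. by rewrite /agree !in_sreorient; case: ifP => // _; rewrite orbC. Qed.

Lemma orthogonalE X Y :
  orthogonal X Y = ([exists x, agree X Y x] == [exists x, agree X (sopp Y) x]).
Proof.
have E (S S' : {set T}) (p : pred T) :
    (forall x, p x = (x \in S :|: S')) -> (S :|: S' == set0) = ~~ [exists x, p x].
  move=> pE; apply/eqP/existsPn => [S0 x|np]; first by rewrite pE S0 inE.
  by apply/setP => x; rewrite -pE inE (negbTE (np x)).
rewrite /orthogonal (E _ _ (agree X Y)) => [|x]; last by rewrite !inE.
rewrite (E _ _ (agree X (sopp Y))) => [|x]; last by rewrite !inE.
by rewrite -[in LHS](inj_eq negb_inj) !negbK.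
Qed.

Lemma orthogonal_opp X Y : orthogonal X (sopp Y) = orthogonal X Y.
Proof. by rewrite !orthogonalE soppK eq_sym. Qed.

Lemma orthogonal_sym X Y : orthogonal X Y = orthogonal Y X.
Proof.
rewrite !orthogonalE; congr (_ == _); apply: eq_existsb => x; rewrite agree_sym //.
by rewrite agree_oppl.
Qed.

Lemma orthogonal_disagree X Y x : orthogonal X Y ->
  agree X Y x -> exists y, agree X (sopp Y) y.
Proof.
by rewrite orthogonalE => /eqP + xXY => E; apply/existsP; rewrite -E; apply/existsP; exists x.
Qed.

Lemma orthogonal_agree X Y x : orthogonal X Y ->
  agree X (sopp Y) x -> exists y, agree X Y y.
Proof.
by rewrite -orthogonal_opp => o /(orthogonal_disagree o); rewrite soppK.
Qed.

Lemma orthogonalI X Y :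
  (forall x, agree X Y x -> exists y, agree X (sopp Y) y) ->
  (forall x, agree X (sopp Y) x -> exists y, agree X Y y) -> orthogonal X Y.
Proof.
move=> h1 h2; rewrite orthogonalE; apply/eqP; apply/idP/idP => /existsP[x].
  by move/h1 => ?; apply/existsP.
by move/h2 => ?; apply/existsP.
Qed.

Lemma orthogonal_reorient A X Y :
  orthogonal (sreorient A X) (sreorient A Y) = orthogonal X Y.
Proof.
rewrite !orthogonalE -sreorient_opp; congr (_ == _);
by apply: eq_existsb => x; rewrite agree_reorient.
Qed.

Lemma orthogonal_srem x X Y : x \notin supp X ->
  orthogonal X (srem x Y) = orthogonal X Y.
Proof.
rewrite in_supp => /norP[/negbTE x1 /negbTE x2].
rewrite !orthogonalE; congr (_ == _); apply: eq_existsb => y;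
by rewrite /agree !inE; case: eqP => //= ->; rewrite x1 x2.
Qed.

(** Orthogonality supplies an element of disagreement, and [y] is the only
    candidate. This is how signs are transported in all that follows. *)
Lemma orthogonal_pair X Y x y : [disjoint X.1 & X.2] -> [disjoint Y.1 & Y.2] ->
  orthogonal X Y -> supp X :&: supp Y \subset [set x; y] ->
  agree X Y x -> agree X (sopp Y) y.
Proof.
move=> dX dY o /subsetP sXY axy.
have [z az] := orthogonal_disagree o axy.
have := sXY z; rewrite !inE; have := agree_supp az; rewrite supp_opp !in_supp.
move=> -> /(_ isT) /orP[]/eqP zE; last by rewrite -zE.
by move: az; rewrite zE (agree_not dX dY axy).
Qed.

Lemma orthogonal_pairE X Y x y : [disjoint X.1 & X.2] -> [disjoint Y.1 & Y.2] ->
  orthogonal X Y -> supp X :&: supp Y \subset [set x; y] ->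
  x \in supp X -> x \in supp Y -> agree X (sopp Y) y = agree X Y x.
Proof.
move=> dX dY o sXY xX xY; case axy: (agree X Y x).
  exact: orthogonal_pair axy.
have := agree_or xX xY; rewrite axy /= => axy'.
have ay : agree X Y y.
  rewrite -[Y]soppK; apply: orthogonal_pair axy' => //.
  - by rewrite disjoint_opp.
  - by rewrite orthogonal_opp.
  - by rewrite supp_opp.
exact: agree_not.
Qed.

Lemma orthogonal_single X Y x : [disjoint X.1 & X.2] -> [disjoint Y.1 & Y.2] ->
  orthogonal X Y -> supp X :&: supp Y \subset [set x] ->
  x \in supp X -> x \notin supp Y.
Proof.
move=> dX dY o sXY xX; apply/negP => xY.
have sXY' : supp X :&: supp Y \subset [set x; x] by rewrite setUid.
have := orthogonal_pairE dX dY o sXY' xX xY.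
case axy: (agree X Y x); first by rewrite (agree_not dX dY axy).
by have := agree_or xX xY; rewrite axy /= => ->.
Qed.

End SignedSetTheory.

(** * Circuits and bases *)

Section Matroid.
Variables (T : finType) (N : omdata T).
Implicit Types (X Y Z C D : signed T) (x y e b u v : T) (A B S : {set T}).

Lemma basesP B : reflect
  [/\ B \subset ground N, (forall X, X \in circuits N -> ~~ (supp X \subset B)) &
      forall x, x \in ground N -> x \notin B ->
        exists2 X, X \in circuits N & supp X \subset x |: B]
  (B \in bases N).
Proof.
rewrite inE; apply: (iffP maxsetP) => [[/andP[sB /forall_inP iB] mB]|[sB iB cB]].
  split=> // x xN xB; apply/exists_inP; apply: contraNT xB => /exists_inPn noX.
  rewrite -(mB (x |: B)) ?setU11 ?subsetU1 //.
  rewrite /independent subUset sub1set xN sB /=.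
  by apply/forall_inP => X /noX.
split=> [|C /andP[sC /forall_inP iC] sBC].
  by rewrite /independent sB; apply/forall_inP.
apply/eqP; rewrite eqEsubset sBC andbT; apply/subsetP => x xC.
apply: contraT => xB; have [X XN sX] := cB x (subsetP sC x xC) xB.
have /negP[] := iC X XN; apply: subset_trans sX _.
by rewrite subUset sub1set xC.
Qed.

Lemma basis_ground B : B \in bases N -> B \subset ground N.
Proof. by case/basesP. Qed.

Lemma basis_indep B X : B \in bases N -> X \in circuits N -> ~~ (supp X \subset B).
Proof. by case/basesP => _ + _; apply. Qed.

Lemma independent_extend S : independent N S -> exists2 B, B \in bases N & S \subset B.
Proof. by case/maxset_exists => B mB sSB; exists B => //; rewrite inE. Qed.

Hypothesis hN : oriented_matroid N.

Lemma circuit_disjoint X : X \in circuits N -> [disjoint X.1 & X.2].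
Proof. by case/(om_signed hN). Qed.

Lemma circuit_ground X : X \in circuits N -> supp X \subset ground N.
Proof. by case/(om_signed hN). Qed.

Lemma circuit_opp X : (sopp X \in circuits N) = (X \in circuits N).
Proof. by apply/idP/idP => /(om_opp hN) //; rewrite soppK. Qed.

(** Weak elimination. Quantifying over [D] records the signs of [Z] against any
    reference: where [D] disagrees with neither [X] nor [Y], it does not
    disagree with [Z]. *)
Lemma circuit_eliminate X Y u : X \in circuits N -> Y \in circuits N ->
  X <> sopp Y -> agree X (sopp Y) u ->
  exists2 Z, Z \in circuits N &
    supp Z \subset (supp X :|: supp Y) :\ u /\
    (forall D x, agree D Z x -> agree D X x || agree D Y x).
Proof.
move=> XN YN nXY aXY.
have [Z ZN [/subsetP s1 /subsetP s2]] : exists2 Z, Z \in circuits N &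
  Z.1 \subset (X.1 :|: Y.1) :\ u /\ Z.2 \subset (X.2 :|: Y.2) :\ u.
  case/orP: aXY => /andP[uX uY]; first by apply: om_elimination; rewrite // inE uX.
  rewrite [X.1 :|: _]setUC [X.2 :|: _]setUC.
  apply: om_elimination => //; last by rewrite inE uY.
  by move=> E; apply: nXY; rewrite E soppK.
exists Z => //; split=> [|D x].
  apply/subsetP => x; rewrite in_supp => /orP[/s1|/s2]; rewrite !inE;
  by case/andP=> -> /orP[]->; rewrite ?orbT.
by case/orP => /andP[xD] => [/s1|/s2]; rewrite !inE => /andP[_ /orP[] xXY];
  rewrite /agree xD xXY ?orbT.
Qed.

Lemma circuit_eliminate_supp X Y u : X \in circuits N -> Y \in circuits N ->
  supp X != supp Y -> u \in supp X -> u \in supp Y ->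
  exists2 Z, Z \in circuits N & supp Z \subset (supp X :|: supp Y) :\ u.
Proof.
move=> XN YN nXY uX uY; have /orP[aXY|aXY] := agree_or uX uY.
  rewrite -(supp_opp Y).
  have [||||Z ZN [sZ _]] := @circuit_eliminate X (sopp Y) u; rewrite ?circuit_opp ?soppK //.
    by move=> E; rewrite E eqxx in nXY.
  by exists Z.
have [||||Z ZN [sZ _]] := @circuit_eliminate X Y u => //.
  by move=> E; rewrite E supp_opp eqxx in nXY.
by exists Z.
Qed.

Lemma fund_elt B e X : B \in bases N -> X \in circuits N ->
  supp X \subset e |: B -> e \in supp X.
Proof.
move=> BN XN sX; apply: contraT => eX; have /negP[] := basis_indep BN XN.
apply/subsetP => x xX; have := subsetP sX x xX; rewrite in_setU1 => /predU1P[E|//].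
by rewrite -E xX in eX.
Qed.

(** Two circuits in the same set [e |: B] can be eliminated at [e], which would
    leave a circuit inside [B]. *)
Lemma fund_uniq B e X Y : B \in bases N -> X \in circuits N -> Y \in circuits N ->
  supp X \subset e |: B -> supp Y \subset e |: B -> X = Y \/ X = sopp Y.
Proof.
move=> BN XN YN sX sY; have [E|nE] := eqVneq (supp X) (supp Y).
  by apply: (om_incomparable hN); rewrite ?E.
have [Z ZN sZ] := circuit_eliminate_supp XN YN nE (fund_elt BN XN sX) (fund_elt BN YN sY).
have /negP[] := basis_indep BN ZN; apply: subset_trans sZ _.
by rewrite subDset subUset sX.
Qed.

Lemma fund_uniq_supp B e X Y : B \in bases N -> X \in circuits N -> Y \in circuits N ->
  supp X \subset e |: B -> supp Y \subset e |: B -> supp X = supp Y.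
Proof.
by move=> BN XN YN sX sY; have [->|->] := fund_uniq BN XN YN sX sY; rewrite ?supp_opp.
Qed.

Lemma fund_circuit_exists B e : B \in bases N -> e \in ground N -> e \notin B ->
  exists2 X, X \in circuits N & supp X \subset e |: B /\ e \in X.1.
Proof.
move=> BN eN eB; have /basesP[_ _ /(_ e eN eB)[X XN sX]] := BN.
have := fund_elt BN XN sX; rewrite in_supp => /orP[eX|eX]; first by exists X.
by exists (sopp X); rewrite ?circuit_opp ?supp_opp.
Qed.

Lemma fund_circuitP B e : B \in bases N -> e \in ground N -> e \notin B ->
  [/\ fund_circuit N B e \in circuits N, supp (fund_circuit N B e) \subset e |: B &
      e \in (fund_circuit N B e).1].
Proof.
move=> BN eN eB; rewrite /fund_circuit; case: pickP => [X /and3P[]//|noX].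
have [X XN [sX eX]] := fund_circuit_exists BN eN eB.
by have := noX X; rewrite XN sX eX.
Qed.

(** A circuit inside the new set would be a circuit inside [v |: B], hence have
    the support of [X] and contain [u]; and a fundamental circuit through [u] is
    replaced by what remains after eliminating [u] against [X]. *)
Lemma basis_exchange B v u X : B \in bases N -> v \notin B -> X \in circuits N ->
  supp X \subset v |: B -> u \in supp X -> u != v -> v |: (B :\ u) \in bases N.
Proof.
move=> BN vB XN sX uX uv; have /basesP[sB iB cB] := BN.
have vX := fund_elt BN XN sX.
have vN := subsetP (circuit_ground XN) v vX.
apply/basesP; split.
- rewrite subUset sub1set vN; exact: subset_trans (subsetDl _ _) sB.
- move=> Y YN; apply/negP => sY.
  have sY' : supp Y \subset v |: B by apply: subset_trans sY (setUS _ (subsetDl _ _)).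
  have := subsetP sY u; rewrite (fund_uniq_supp BN YN XN sY' sX) uX !inE eqxx (negbTE uv).
  by move/(_ isT).
move=> x xN; rewrite !inE negb_or negb_and negbK => /andP[xv xB].
have [xu|xu] := eqVneq x u.
  exists X => //; apply: subset_trans sX _; apply/subsetP => y; rewrite !inE xu.
  by case: (y == v); case: (y == u).
rewrite (negbTE xu) /= in xB; have [Y YN sY] := cB x xN xB.
have xY := fund_elt BN YN sY.
have [uY|uY] := boolP (u \in supp Y); last first.
  exists Y => //; apply/subsetP => y yY; have := subsetP sY y yY; rewrite !inE.
  have -> : y != u by apply: contraNneq uY => <-.
  by case: (y == x); case: (y == v).
have [|Z ZN sZ] := circuit_eliminate_supp XN YN _ uX uY.
  apply/eqP => E; have := subsetP sX x; rewrite E xY !inE (negbTE xv) (negbTE xB).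
  by move/(_ isT).
exists Z => //; apply: subset_trans sZ _; apply/subsetP => y.
rewrite in_setD1 in_setU => /andP[yu /orP[/(subsetP sX)|/(subsetP sY)]];
by rewrite !inE yu; case: (y == v); case: (y == x).
Qed.

End Matroid.

(** * Extending orthogonality from fundamental circuits to all circuits *)

Section Duality.
Variables (T : finType) (N : omdata T).
Hypothesis hN : oriented_matroid N.
Implicit Types (X Y Z C D : signed T) (x y e b u v : T) (A B S : {set T}).

(** The failure of orthogonality, up to replacing [Y] by [sopp Y]. *)
Definition conforms D Y : Prop :=
  (exists x, agree D Y x) /\ (forall x, ~~ agree D (sopp Y) x).

Lemma not_conforms_orthogonal D Y :
  ~ conforms D Y -> ~ conforms D (sopp Y) -> orthogonal D Y.
Proof.
move=> h1 h2; apply: orthogonalI => x ax; apply/existsP; apply: contraT => /existsPn no.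
  by case: h1; split=> //; exists x.
by case: h2; split; [exists x | rewrite soppK].
Qed.

Lemma orthogonal_not_conforms D Y : orthogonal D Y -> ~ conforms D Y.
Proof.
by move=> o [[x ax] no]; have [y ay] := orthogonal_disagree o ax; have := no y; rewrite ay.
Qed.

(** For a basis [B] this is orthogonality to the fundamental circuits of [B], the
    only circuits contained in some [e |: B]. *)
Definition fund_orthogonal D B : Prop :=
  forall C e, C \in circuits N -> supp C \subset e |: B -> orthogonal D C.

Section Signing.
Variables (D : signed T) (b : T).
Hypothesis dD : [disjoint D.1 & D.2].

(** Otherwise [C] would meet [supp D] in [b] alone. *)
Lemma fund_avoid B v C : supp D :&: B = [set b] -> fund_orthogonal D B ->
  C \in circuits N -> supp C \subset v |: B -> v \notin supp D ->
  forall x, x \in supp C -> x \notin supp D.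
Proof.
move=> DB oB CN sC vD x xC; apply/negP => xD.
have dC := circuit_disjoint hN CN.
have : supp D :&: supp C \subset [set x].
  have sub y : y \in supp D -> y \in supp C -> y = b.
    move=> yD yC; have := subsetP sC y yC; rewrite in_setU1 => /predU1P[yv|yB].
      by rewrite yv (negbTE vD) in yD.
    by apply/set1P; rewrite -DB inE yD.
  apply/subsetP => y; rewrite in_setI => /andP[yD yC].
  by rewrite inE (sub y yD yC) (sub x xD xC).
by move=> /(orthogonal_single dD dC (oB C v CN sC))/(_ xD); rewrite xC.
Qed.

(** Exchanging [u] for an element [v] outside [supp D] keeps [D] orthogonal to
    the fundamental circuits. A fundamental circuit [C2] of the new basis that
    conforms to [D] must contain [v]; eliminating [v] against [C], which avoids
    [D], gives a fundamental circuit [Z] of [B]. If [Z] meets [D], it conforms to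
    [D] and contradicts [fund_orthogonal D B]. If not, [b] lies in [C2] but not in
    [Z] nor in [C]; then [Z], or what eliminating [u] between [Z] and [C] leaves,
    is a second fundamental circuit of [e] for the new basis, without [b]. *)
Lemma fund_orthogonal_exchange B v u C : B \in bases N ->
  supp D :&: B = [set b] -> fund_orthogonal D B ->
  v \notin B -> v \notin supp D -> C \in circuits N -> supp C \subset v |: B ->
  u \in supp C -> u != v -> fund_orthogonal D (v |: (B :\ u)).
Proof.
move=> BN DB oB vB vD CN sC uC uv.
have B'N := basis_exchange hN BN vB CN sC uC uv.
have CD := fund_avoid DB oB CN sC vD.
have vC := fund_elt BN CN sC.
have nc C2 e : C2 \in circuits N -> supp C2 \subset e |: (v |: (B :\ u)) ->
    ~ conforms D C2.
  move=> C2N sC2 cC2.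
  have eC2 := fund_elt B'N C2N sC2.
  have [vC2|vC2] := boolP (v \in supp C2); last first.
    apply: (orthogonal_not_conforms (oB C2 e C2N _)) cC2.
    apply/subsetP => y yC; have := subsetP sC2 y yC; rewrite !inE.
    have /negbTE-> : y != v by apply: contraNneq vC2 => <-.
    by case: (y == e); case: (y == u).
  have nCC2 : supp C != supp C2.
    apply/eqP => E; case: cC2 => -[x /agree_supp/andP[xD]]; rewrite -E => /CD.
    by rewrite xD.
  have eB : e \notin B.
    apply/negP => eB; have /eqP[] := nCC2.
    apply: (fund_uniq_supp hN BN CN C2N sC).
    apply: subset_trans sC2 _; apply/subsetP => y; rewrite !inE.
    by case/or3P => [/eqP->|->|/andP[_ ->]] //; rewrite ?eB ?orbT.
  have ev : e != v.
    apply/eqP => ev; have /negP[] := basis_indep B'N C2N.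
    by apply: subset_trans sC2 _; rewrite ev setUA setUid.
  (* C avoids D, so Z can conflict with D only where C2 does *)
  have [C3 [C3N C3s aC3]] : exists C3, [/\ C3 \in circuits N, supp C3 = supp C &
      agree C2 (sopp C3) v].
    have /orP[a|a] := agree_or vC2 vC; last by exists C.
    by exists (sopp C); rewrite circuit_opp ?supp_opp ?soppK.
  have [|Z ZN [sZ cZ]] := circuit_eliminate hN C2N C3N _ aC3.
    by move=> E; move: nCC2; rewrite E supp_opp C3s eqxx.
  have sZe : supp Z \subset e |: B.
    apply: subset_trans sZ _; apply/subsetP => y.
    rewrite in_setD1 in_setU => /andP[yv /orP[/(subsetP sC2)|]].
      by rewrite !inE (negbTE yv) => /orP[->|/andP[_ ->]] //; rewrite orbT.
    by rewrite C3s => /(subsetP sC); rewrite !inE (negbTE yv) /= => ->; rewrite orbT.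
  have aZ D' x : x \in supp D -> agree D' Z x -> agree D' C2 x.
    move=> xD /cZ/orP[//|/agree_supp/andP[_]].
    by rewrite C3s => /CD; rewrite xD.
  have ZD x : x \in supp Z -> x \notin supp D.
    move=> xZ; apply/negP => xD; apply: (orthogonal_not_conforms (oB Z e ZN sZe)).
    have no y : ~~ agree D (sopp Z) y.
      apply/negP => ay; have /andP[yD _] := agree_supp ay.
      case: cC2 => _ /(_ y)/negP[]; rewrite -agree_oppl.
      by apply: aZ => //; rewrite agree_oppl.
    split=> //; exists x; have /orP[//|ax] := agree_or xD xZ.
    by have := no x; rewrite ax.
  have eZ := fund_elt BN ZN sZe.
  have bC2 : b \in supp C2.
    case: cC2 => -[x /agree_supp/andP[xD xC2]] _.
    have := subsetP sC2 x xC2; rewrite !in_setU1 in_setD1.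
    case/or3P => [/eqP E|/eqP E|/andP[_ xB]].
    - by have := ZD e eZ; rewrite -E xD.
    - by rewrite -E xD in vD.
    - have /set1P <- // : x \in [set b] by rewrite -DB inE xD.
  have bD : b \in supp D by have := set11 b; rewrite -DB inE => /andP[].
  have bZ : b \notin supp Z by apply: contraL bD; exact: ZD.
  have bC : b \notin supp C by apply: contraL bD; exact: CD.
  have bad Z' : Z' \in circuits N -> supp Z' \subset e |: (v |: (B :\ u)) ->
      b \notin supp Z' -> False.
    move=> Z'N sZ' /negP[].
    by rewrite (fund_uniq_supp hN B'N Z'N C2N sZ' sC2).
  have [uZ|uZ] := boolP (u \in supp Z).
    have [|Z' Z'N sZ'] := circuit_eliminate_supp hN ZN CN _ uZ uC.
      apply/eqP => E; have := subsetP sC e; rewrite -E eZ !inE (negbTE ev) (negbTE eB).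
      by move/(_ isT).
    apply: (bad Z' Z'N).
      apply: subset_trans sZ' _; apply/subsetP => y.
      rewrite in_setD1 in_setU => /andP[yu /orP[/(subsetP sZe)|/(subsetP sC)]];
      by rewrite !inE yu; case: (y == e); case: (y == v).
    apply/negP => /(subsetP sZ'); rewrite in_setD1 in_setU (negbTE bZ) (negbTE bC).
    by rewrite andbF.
  apply: (bad Z ZN) => //; apply/subsetP => y yZ.
  have yu : y != u by apply: contraNneq uZ => <-.
  by have := subsetP sZe y yZ; rewrite !inE yu; case: (y == e); case: (y == v).
move=> C2 e C2N sC2; apply: not_conforms_orthogonal; first exact: nc sC2.
by apply: (nc _ e); rewrite ?circuit_opp ?supp_opp.
Qed.

(** Orthogonality to the fundamental circuits of one basis extends to all
    circuits. Among the circuits [Y] conforming to [D] and the bases [B'] with the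
    same hypotheses as [B], consider a pair with [supp Y :\: B'] smallest. An
    element [v] of it outside [supp D] could be exchanged into [B'] for an element
    outside [Y]. So [supp Y :\: B'] lies in [supp D]; eliminating one of its
    elements [d] against the fundamental circuit of [d] creates no conflict with
    [D], and the result still meets [D], being otherwise contained in [B']. It is
    a smaller counterexample. Only weak elimination is used. *)
Lemma fund_orthogonal_all B : B \in bases N -> supp D :&: B = [set b] ->
  fund_orthogonal D B -> forall Y, Y \in circuits N -> orthogonal D Y.
Proof.
move=> BN DB oB.
suff nc n B' Y : #|supp Y :\: B'| < n -> B' \in bases N -> supp D :&: B' = [set b] ->
    fund_orthogonal D B' -> Y \in circuits N -> ~ conforms D Y.
  move=> Y YN; apply: not_conforms_orthogonal.
    exact: (nc _ _ _ (ltnSn _) BN DB oB).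
  by apply: (nc _ _ _ (ltnSn _) BN DB oB); rewrite circuit_opp.
elim: n B' Y {BN DB oB} => // n IHn B' Y; rewrite ltnS => leYn B'N DB oB YN cY.
have [/existsP[v /and3P[vY vB vD]]|/existsPn noV] :=
  boolP [exists v, [&& v \in supp Y, v \notin B' & v \notin supp D]].
  have vN := subsetP (circuit_ground hN YN) v vY.
  have [C CN [sC _]] := fund_circuit_exists hN B'N vN vB.
  have CD := fund_avoid DB oB CN sC vD.
  have vC := fund_elt B'N CN sC.
  have /subsetPn[u uC uY] : ~~ (supp C \subset supp Y).
    apply/negP => /(om_incomparable hN CN YN) CY.
    case: cY => -[x /agree_supp/andP[xD xY]] _.
    have : x \in supp C by case: CY => ->; rewrite ?supp_opp.
    by move=> /CD; rewrite xD.
  have uv : u != v by apply: contraNneq uY => ->.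
  have uB : u \in B'.
    by have := subsetP sC u uC; rewrite !inE (negbTE uv).
  have sY' : supp Y :\: (v |: (B' :\ u)) \proper supp Y :\: B'.
    apply/properP; split.
      apply/subsetP => y; rewrite !in_setD => /andP[+ yY]; rewrite yY andbT.
      rewrite !inE negb_or negb_and negbK => /andP[_ /orP[/eqP yu|//]].
      by rewrite yu (negbTE uY) in yY.
    by exists v; rewrite !in_setD ?vB ?vY // setU11.
  apply: (IHn (v |: (B' :\ u)) Y _ _ _ _ YN cY).
  - exact: leq_trans (proper_card sY') leYn.
  - exact: basis_exchange sC uC uv.
  - apply/setP => x; rewrite -DB !in_setI; case xD: (x \in supp D) => //=.
    rewrite !inE; have -> : (x == v) = false by apply: contraNF vD => /eqP <-.
    by have -> : x != u by apply: contraTneq (CD u uC) => <-; rewrite xD.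
  - exact: fund_orthogonal_exchange sC uC uv.
have /subsetPn[d dY dB] := basis_indep B'N YN.
have d_D : d \in supp D by have := noV d; rewrite dY dB /= negbK.
have dN := subsetP (circuit_ground hN YN) d dY.
have [C [CN sC aC]] : exists C, [/\ C \in circuits N, supp C \subset d |: B' &
    agree Y (sopp C) d].
  have [C CN [sC dC]] := fund_circuit_exists hN B'N dN dB.
  have /orP[a|a] : agree Y C d || agree Y (sopp C) d.
  - by apply: agree_or => //; rewrite in_supp dC.
  - by exists (sopp C); rewrite circuit_opp ?supp_opp ?soppK.
  by exists C.
have oC := oB C d CN sC.
have nYC : Y <> sopp C.
  by move=> E; apply: (@orthogonal_not_conforms D Y) => //; rewrite E orthogonal_opp.
have [Z ZN [sZ cZ]] := circuit_eliminate hN YN CN nYC aC.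
(* D disagrees with C at d, hence agrees with C at b and conflicts nowhere else *)
have aDCd : agree D (sopp C) d.
  have aY : agree D Y d.
    by have /orP[//|a] := agree_or d_D dY; case: cY => _ /(_ d); rewrite a.
  case: cY => _ /(_ d); move: aC aY; rewrite /agree /=.
  by do 6!case: (d \in _).
have [x0 ax0] := orthogonal_agree oC aDCd.
have x0b x : agree D C x -> x = b.
  move=> ax; have /andP[xD xC] := agree_supp ax.
  have := subsetP sC x xC; rewrite in_setU1 => /predU1P[E|xB].
    move: aDCd; rewrite -E.
    by rewrite (agree_not dD (circuit_disjoint hN CN) ax).
  by apply/set1P; rewrite -DB inE xD.
have noC x : x != d -> ~~ agree D (sopp C) x.
  move=> xd; apply/negP => ax; have /andP[xD] := agree_supp ax; rewrite supp_opp => xC.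
  have := subsetP sC x xC; rewrite in_setU1 (negbTE xd) /= => xB.
  have xb : x = b by apply/set1P; rewrite -DB inE xD.
  by move: ax; rewrite xb -(x0b _ ax0) (agree_not dD (circuit_disjoint hN CN) ax0).
have noZ x : ~~ agree D (sopp Z) x.
  apply/negP => ax; have /andP[_] := agree_supp ax; rewrite supp_opp => xZ.
  have /andP[xd _] : (x != d) && (x \in supp Y :|: supp C).
    by have := subsetP sZ x xZ; rewrite in_setD1.
  have := cZ (sopp D) x; rewrite !agree_oppl => /(_ ax)/orP[]; apply/negP.
    by case: cY.
  exact: noC.
have sZB x : x \in supp Z -> x \notin B' -> x \in supp D /\ x \in supp Y :\: B'.
  move=> xZ xB; have := subsetP sZ x xZ; rewrite in_setD1 in_setU => /andP[xd].
  case/orP => [xY|/(subsetP sC)]; last by rewrite !inE (negbTE xd) (negbTE xB).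
  by have := noV x; rewrite xY xB /= negbK in_setD xB xY.
have /subsetPn[z zZ zB] := basis_indep B'N ZN.
apply: (IHn B' Z _ B'N DB oB ZN); last first.
  split=> //; exists z; have [zD _] := sZB z zZ zB.
  by have /orP[//|a] := agree_or zD zZ; have := noZ z; rewrite a.
apply: leq_trans leYn; apply: proper_card; apply/properP; split.
  by apply/subsetP => x; rewrite in_setD => /andP[xB xZ]; case: (sZB x xZ xB).
exists d; first by rewrite in_setD dB.
by rewrite in_setD; apply/negP => /andP[_ /(subsetP sZ)]; rewrite in_setD1 eqxx.
Qed.

End Signing.
End Duality.

(** * Cocircuits *)

Section Cocircuits.
Variables (T : finType) (N : omdata T).
Hypothesis hN : oriented_matroid N.
Implicit Types (X Y Z C D : signed T) (x y e b u v : T) (A B S : {set T}).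

Lemma cocircuit_disjoint X : X \in cocircuits N -> [disjoint X.1 & X.2].
Proof. by rewrite inE => /and3P[]. Qed.

Lemma cocircuit_orthogonal X Y :
  X \in cocircuits N -> Y \in circuits N -> orthogonal X Y.
Proof. by rewrite inE => /and3P[_ _ /forall_inP]; apply. Qed.

Lemma cocircuit_opp X : (sopp X \in cocircuits N) = (X \in cocircuits N).
Proof.
suff opp Y : Y \in cocircuits N -> sopp Y \in cocircuits N.
  by apply/idP/idP => /opp //; rewrite soppK.
rewrite !inE disjoint_opp supp_opp => /and3P[-> -> /forall_inP oY] /=.
apply/forall_inP => Z ZN.
by rewrite orthogonal_sym orthogonal_opp orthogonal_sym oY.
Qed.

Lemma cocircuit_meets X B : X \in cocircuits N -> B \in bases N ->
  exists2 x, x \in supp X & x \in B.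
Proof.
rewrite inE => /and3P[_ /minsetp/forall_inP mX _] /mX/set0Pn[x].
by rewrite in_setI => /andP[xX xB]; exists x.
Qed.

(** By minimality some basis misses [supp X :\ b]. *)
Lemma cocircuit_basis X b : X \in cocircuits N -> b \in supp X ->
  exists2 B, B \in bases N & supp X :&: B = [set b].
Proof.
rewrite inE => /and3P[_ /minsetP[mX minX] _] bX.
have [/minX E|] := boolP [forall B in bases N, (supp X :\ b) :&: B != set0].
  by have := setD11 b (supp X); rewrite E ?subsetDl // bX.
case/forall_inPn => B BN /negbNE/eqP XB; exists B => //.
have /set0Pn[x] := forall_inP mX B BN.
rewrite in_setI => /andP[xX xB].
have E y : y \in supp X -> y \in B -> y = b.
  move=> yX yB; apply/eqP; apply: contraT => yb.
  by have := in_set0 y; rewrite -XB in_setI in_setD1 yb yX yB.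
have xb := E x xX xB.
apply/setP => y; rewrite in_setI in_set1; apply/andP/eqP => [[yX yB]|->].
  exact: E.
by rewrite -xb.
Qed.

Lemma cocircuit_ground X : X \in cocircuits N -> supp X \subset ground N.
Proof.
move=> XN; apply/subsetP => b /(cocircuit_basis XN)[B BN XB].
by apply: (subsetP (basis_ground BN)); have := set11 b; rewrite -XB in_setI => /andP[].
Qed.

Lemma meet_fund X C B b e : supp X :&: B = [set b] -> supp C \subset e |: B ->
  supp X :&: supp C \subset [set b; e].
Proof.
move=> XB sC; apply/subsetP => x; rewrite in_setI => /andP[xX /(subsetP sC)].
rewrite in_setU1 in_set2 => /predU1P[->|xB]; first by rewrite eqxx orbT.
by apply/orP; left; apply/eqP/set1P; rewrite -XB in_setI xX.
Qed.

(** [X] meets the fundamental circuit [C] of [e] in at most [b] and [e], so that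
    its sign at [b] decides its sign at [e]. *)
Lemma fund_sign X C B b e : [disjoint X.1 & X.2] -> orthogonal X C ->
  supp X :&: B = [set b] -> C \in circuits N -> supp C \subset e |: B ->
  e \in C.1 ->
  ((e \in X.1) = agree X (sopp C) b) * ((e \in X.2) = agree X C b).
Proof.
move=> dX oXC XB CN sC eC.
have dC := circuit_disjoint hN CN.
have sXC := meet_fund XB sC.
have bX : b \in supp X by have := set11 b; rewrite -XB in_setI => /andP[].
have aE : (agree X C e = (e \in X.1)) * (agree X (sopp C) e = (e \in X.2)).
  by rewrite /agree /= eC (disjointFr dC eC) !andbT !andbF orbF.
have [bC|bC] := boolP (b \in supp C).
  split; rewrite -aE; last by apply: orthogonal_pairE.
  rewrite -{1}(soppK C); apply: orthogonal_pairE; rewrite ?disjoint_opp ?supp_opp //.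
  by rewrite orthogonal_opp.
have noa Y : supp Y = supp C -> agree X Y b = false.
  by move=> E; apply: contraNF bC => /agree_supp; rewrite E => /andP[].
rewrite !noa ?supp_opp //.
have : e \notin supp X.
  apply/negP => eX; have : e \notin supp C.
    apply: orthogonal_single eX => //; apply/subsetP => x xXC.
    have := subsetP sXC x xXC; rewrite in_set2 in_set1 => /orP[/eqP xb|//].
    by move: xXC; rewrite xb in_setI (negbTE bC) andbF.
  by rewrite in_supp eC.
by rewrite in_supp negb_or => /andP[/negbTE-> /negbTE->].
Qed.

(** Both are determined, up to a global sign, by [fund_sign]. *)
Lemma fund_sign_uniq X Y B b : [disjoint X.1 & X.2] -> [disjoint Y.1 & Y.2] ->
  (forall C, C \in circuits N -> orthogonal X C /\ orthogonal Y C) ->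
  supp X \subset ground N -> supp Y \subset ground N ->
  B \in bases N -> supp X :&: B = [set b] -> supp Y :&: B = [set b] ->
  X = Y \/ X = sopp Y.
Proof.
move=> dX dY oXY sX sY BN XB YB.
have [bX bB] : b \in supp X /\ b \in B.
  by have := set11 b; rewrite -XB in_setI => /andP[].
have bY : b \in supp Y by have := set11 b; rewrite -YB in_setI => /andP[].
suff main Z : [disjoint Z.1 & Z.2] -> (forall C, C \in circuits N -> orthogonal Z C) ->
    supp Z = supp Y -> agree X Z b -> X = Z.
  have /orP[a|a] := agree_or bX bY; [left|right]; apply: main => //.
  - by move=> C /oXY[].
  - by rewrite disjoint_opp.
  - move=> C /oXY[_]; rewrite orthogonal_sym => o.
    by rewrite orthogonal_sym orthogonal_opp.
  - exact: supp_opp.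
move=> dZ oZ ZY a.
have bXZ := agree_eq dX dZ a.
have main e : ((e \in X.1) = (e \in Z.1)) * ((e \in X.2) = (e \in Z.2)).
  have [eN|eN] := boolP (e \in ground N); last first.
    have : e \notin supp X by apply: contra eN; apply: (subsetP sX).
    have : e \notin supp Z by rewrite ZY; apply: contra eN; apply: (subsetP sY).
    by rewrite !in_supp !negb_or => /andP[/negbTE-> /negbTE->] /andP[/negbTE-> /negbTE->].
  have [eB|eB] := boolP (e \in B).
    have [->|eb] := eqVneq e b; first exact: bXZ.
    have no W : supp W :&: B = [set b] -> (e \in W.1 = false) * (e \in W.2 = false).
      move=> WB; have : e \notin supp W.
        by apply: contra eb => eW; apply/eqP/set1P; rewrite -WB in_setI eW.
      by rewrite in_supp negb_or => /andP[/negbTE-> /negbTE->].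
    by rewrite !no // ZY.
  have [C CN [sC eC]] := fund_circuit_exists hN BN eN eB.
  rewrite !(fund_sign dX (proj1 (oXY C CN)) XB CN sC eC).
  have ZB : supp Z :&: B = [set b] by rewrite ZY.
  rewrite !(fund_sign dZ (oZ C CN) ZB CN sC eC).
  by rewrite /agree !bXZ.
by apply: signed_eq => e; rewrite main.
Qed.

Lemma cocircuit_uniq X Y B b : X \in cocircuits N -> Y \in cocircuits N ->
  B \in bases N -> supp X :&: B = [set b] -> supp Y :&: B = [set b] ->
  X = Y \/ X = sopp Y.
Proof.
move=> XN YN; apply: fund_sign_uniq; rewrite ?cocircuit_disjoint ?cocircuit_ground //.
by move=> C CN; rewrite !cocircuit_orthogonal.
Qed.

(** Orthogonality already forces the support to be a cocircuit. A basis that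
    misses it leaves [b] outside, and the fundamental circuit of [b] would meet
    it in [b] alone; and for [d] in the support, exchanging [b] for [d] in [B]
    gives a basis that meets it in [d] alone, whence minimality. *)
Lemma cocircuit_intro D B b : [disjoint D.1 & D.2] -> supp D \subset ground N ->
  (forall Y, Y \in circuits N -> orthogonal D Y) ->
  B \in bases N -> supp D :&: B = [set b] -> D \in cocircuits N.
Proof.
move=> dD sD oD BN DB; rewrite inE dD /=; apply/andP; split; last exact/forall_inP.
have [bD bB] : b \in supp D /\ b \in B.
  by have := set11 b; rewrite -DB in_setI => /andP[].
apply/minsetP; split=> [|S /forall_inP mS sSD].
  apply/forall_inP => B1 B1N; apply/negP => /eqP DB1.
  have D0 x : x \in supp D -> x \notin B1.
    by move=> xD; apply/negP => xB; have := in_set0 x; rewrite -DB1 in_setI xD xB.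
  have bN := subsetP sD b bD; have bB1 := D0 b bD.
  have [C CN [sC bC]] := fund_circuit_exists hN B1N bN bB1.
  have /negP[] : b \notin supp C; last by rewrite in_supp bC.
  apply: (@orthogonal_single _ D) => //; rewrite ?(circuit_disjoint hN) ?oD //.
  apply/subsetP => x; rewrite in_setI => /andP[xD /(subsetP sC)].
  by rewrite in_setU1 in_set1 (negbTE (D0 x xD)) orbF.
apply/eqP; rewrite eqEsubset sSD; apply/subsetP => d dD'.
have [->|db] := eqVneq d b.
  have /set0Pn[x] := mS B BN; rewrite in_setI => /andP[xS xB].
  by have /set1P <- : x \in [set b]; rewrite // -DB in_setI xB (subsetP sSD).
have dB : d \notin B.
  by apply: contra db => dB; apply/eqP/set1P; rewrite -DB in_setI dD'.
have [C CN [sC dC]] := fund_circuit_exists hN BN (subsetP sD d dD') dB.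
have bC : b \in supp C.
  have := in_supp D d; rewrite dD' !(fund_sign dD (oD C CN) DB CN sC dC).
  by case/esym/orP => /agree_supp/andP[_]; rewrite ?supp_opp.
have B'N : d |: (B :\ b) \in bases N.
  by apply: (basis_exchange hN BN dB CN sC bC); rewrite eq_sym.
have /set0Pn[x] := mS _ B'N; rewrite !inE => /andP[xS /orP[/eqP<- //|/andP[xb xB]]].
by case/negP: xb; rewrite -in_set1 -DB in_setI xB (subsetP sSD).
Qed.

(** Every circuit inside [e |: B] fixes the sign of [e] relative to [b]; the
    resulting signed set is orthogonal to all circuits by [fund_orthogonal_all]. *)
Lemma fund_cocircuit_exists B b : B \in bases N -> b \in B ->
  exists2 D, D \in cocircuits N & supp D :&: B = [set b] /\ b \in D.1.
Proof.
move=> BN bB; pose F := fund_circuit N B.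
pose P := [set e in ground N | (e \notin B) && (b \in (F e).2)].
pose Q := [set e in ground N | (e \notin B) && (b \in (F e).1)].
pose D : signed T := (b |: P, Q).
have bN := subsetP (basis_ground BN) b bB.
have FP e := @fund_circuitP _ _ hN B e BN.
have dD : [disjoint D.1 & D.2].
  apply/pred0P => x /=; rewrite !inE.
  have [->|_] := eqVneq x b; first by rewrite bB /= andbF.
  case xN: (x \in ground N) => //=; case xB: (x \in B) => //=.
  have [FN _ _] := FP x xN (negbT xB).
  by case b1: (b \in (F x).1); rewrite ?andbF // (disjointFr (circuit_disjoint hN FN) b1).
have sD : supp D \subset ground N.
  apply/subsetP => x; rewrite in_supp !inE => /orP[/orP[/eqP->|]|] //;
  by case/andP.
have DB : supp D :&: B = [set b].
  apply/setP => x; rewrite in_setI in_supp !inE.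
  by have [->|xb] := eqVneq x b; rewrite ?bB //=; case: (x \in B); rewrite !andbF.
have oD : fund_orthogonal N D B.
  move=> C e CN sC; have eC := fund_elt BN CN sC.
  have eN := subsetP (circuit_ground hN CN) e eC.
  have eB : e \notin B.
    apply/negP => eB; have /negP[] := basis_indep BN CN.
    by apply: subset_trans sC _; rewrite subUset sub1set eB subxx.
  have [FN sF eF] := FP e eN eB.
  suff oF : orthogonal D (F e).
    by have [->|->] := fund_uniq hN BN CN FN sC sF; rewrite ?orthogonal_opp.
  have dF := circuit_disjoint hN FN.
  have be : (b == e) = false by apply: contraNF eB => /eqP<-.
  have bD2 : b \in Q = false by rewrite inE bB andbF.
  have eD1 : (e \in D.1) = (b \in (F e).2) by rewrite !inE eq_sym be eN eB.
  have eD2 : (e \in D.2) = (b \in (F e).1) by rewrite !inE eN eB.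
  have aE : (agree D (F e) e = (e \in D.1)) * (agree D (sopp (F e)) e = (e \in D.2)).
    by rewrite /agree /= eF (disjointFr dF eF) !andbT !andbF orbF.
  have aB : (agree D (F e) b = (b \in (F e).1)) *
            (agree D (sopp (F e)) b = (b \in (F e).2)).
    by rewrite /agree /= bD2 setU11 !orbF.
  apply: orthogonalI => x ax; have /andP[xD] := agree_supp ax; rewrite ?supp_opp => xF;
    have := subsetP (meet_fund DB sF) x; rewrite in_setI xD xF in_set2 => /(_ isT);
    case/orP => /eqP xE; move: ax; rewrite xE.
  - by rewrite aB -eD2 -aE; exists e.
  - by rewrite aE eD1 -aB; exists b.
  - by rewrite aB -eD1 -aE; exists e.
  - by rewrite aE eD2 -aB; exists b.
exists D; last by split=> //; exact: setU11.
apply: (cocircuit_intro dD sD _ BN DB).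
exact: (fund_orthogonal_all hN dD BN DB oD).
Qed.

Lemma fund_cocircuit_supp B b D : B \in bases N -> D \in cocircuits N ->
  supp D :&: B = [set b] -> supp D = ground N :\: Defs.closure N (B :\ b).
Proof.
move=> BN DN DB; apply/setP => e; rewrite in_setD.
have [bD bB] : b \in supp D /\ b \in B.
  by have := set11 b; rewrite -DB in_setI => /andP[].
have sB' : b |: (B :\ b) = B by rewrite setD1K.
have [eN|eN] := boolP (e \in ground N); rewrite ?andbT ?andbF; last first.
  by apply/negbTE; apply: contra eN; exact: (subsetP (cocircuit_ground DN)).
have dD := cocircuit_disjoint DN.
rewrite /Defs.closure in_setU in_setD1 [e \in [set _ in _ | _]]inE eN /=.
have [eB|eB] := boolP (e \in B).
  rewrite andbT; have [->|eb] := eqVneq e b; last first.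
    by apply/negbTE; apply: contra eb => eD; rewrite -in_set1 -DB in_setI eD.
  rewrite bD /=; apply/esym/exists_inPn => X XN.
  by rewrite sB'; apply: contra (basis_indep BN XN) => /andP[].
rewrite andbF /=.
have [C CN [sC eC]] := fund_circuit_exists hN BN eN eB.
have -> : (e \in supp D) = (b \in supp C).
  rewrite in_supp !(fund_sign dD (cocircuit_orthogonal DN CN) DB CN sC eC).
  apply/idP/idP => [/orP[]/agree_supp/andP[_]|bC]; rewrite ?supp_opp //.
  by rewrite orbC; apply: agree_or.
have eC' : e \in supp C by rewrite in_supp eC.
have eb : b != e by apply: contraNneq eB => <-.
apply/idP/exists_inPn => [bC X XN|no].
  apply/negP => /andP[eX sX]; have sX' : supp X \subset e |: B.
    by apply: subset_trans sX _; rewrite setUS // subsetDl.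
  have := subsetP sX b; rewrite (fund_uniq_supp hN BN XN CN sX' sC) bC.
  by rewrite !inE eqxx (negbTE eb) => /(_ isT).
apply: contraT => bC; have /negP[] := no C CN; rewrite eC' /=.
apply/subsetP => x xC; have := subsetP sC x xC; rewrite !in_setU1 in_setD1.
by have -> : x != b by apply: contraNneq bC => <-.
Qed.

Lemma fund_cocircuitP B b : B \in bases N -> b \in B ->
  [/\ fund_cocircuit N B b \in cocircuits N,
      supp (fund_cocircuit N B b) :&: B = [set b] & b \in (fund_cocircuit N B b).1].
Proof.
move=> BN bB; have [D DN [DB bD]] := fund_cocircuit_exists BN bB.
have sD := fund_cocircuit_supp BN DN DB.
rewrite /fund_cocircuit; case: pickP => [X /and3P[XN /eqP sX bX]|/(_ D)].
  by rewrite sX -sD.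
by rewrite DN bD sD eqxx.
Qed.

(** If [b] were missing from [S] in a larger basis, the fundamental cocircuit of
    [b] would avoid [S]. *)
Lemma independent_meets_basis S : independent N S ->
  (forall D, D \in cocircuits N -> supp D :&: S != set0) -> S \in bases N.
Proof.
move=> iS mS; have [B BN sSB] := independent_extend iS.
suff -> : S = B by [].
apply/eqP; rewrite eqEsubset sSB /=; apply/subsetP => b bB.
have [D DN [DB _]] := fund_cocircuit_exists BN bB.
have /set0Pn[x] := mS D DN; rewrite in_setI => /andP[xD xS].
by have /set1P <- : x \in [set b]; rewrite // -DB in_setI xD (subsetP sSB).
Qed.

End Cocircuits.

(** * Reorientations, generic extensions and generic liftings *)

Section Reorientation.
Variables (T : finType) (N : omdata T).
Implicit Types (X Y Z C D : signed T) (x y e b u v : T) (A B S : {set T}).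

Lemma circuit_reorient A X :
  (X \in circuits (reorient A N)) = (sreorient A X \in circuits N).
Proof. by rewrite -{1}[X](sreorientK A) mem_imset //; exact: inv_inj (@sreorientK T A). Qed.

Lemma bases_reorient A : bases (reorient A N) = bases N.
Proof.
apply/setP => B; rewrite !inE; apply: maxset_eq => S; rewrite /independent; congr (_ && _).
apply/forall_inP/forall_inP => iS X.
  by move=> XN; rewrite -(supp_reorient A) iS // circuit_reorient sreorientK.
by rewrite circuit_reorient => /iS; rewrite supp_reorient.
Qed.

Lemma cocircuit_reorient A X :
  (X \in cocircuits (reorient A N)) = (sreorient A X \in cocircuits N).
Proof.
rewrite !inE supp_reorient bases_reorient; congr [&& _, _ & _].
  apply/idP/idP => [/(disjoint_reorient A)//|/(disjoint_reorient A)].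
  by rewrite sreorientK.
apply/forall_inP/forall_inP => oX Y.
  move=> YN; rewrite -(orthogonal_reorient A) sreorientK oX //.
  by rewrite circuit_reorient sreorientK.
by rewrite circuit_reorient => /oX; rewrite orthogonal_reorient.
Qed.

Lemma reorient_oriented_matroid A :
  oriented_matroid N -> oriented_matroid (reorient A N).
Proof.
move=> hN; split=> [X|||X Y|X Y e]; rewrite ?circuit_reorient.
- move=> XN; split; first by rewrite -(supp_reorient A); apply: (circuit_ground hN).
  by rewrite -[X](sreorientK A); apply: disjoint_reorient; apply: (circuit_disjoint hN).
- have -> : sreorient A (szero T) = szero T.
    by apply: signed_eq => x; rewrite !in_sreorient !inE if_same.
  exact: om_nonzero.
- by move=> X; rewrite !circuit_reorient sreorient_opp (circuit_opp hN).
- move=> XN YN; rewrite -(supp_reorient A X) -(supp_reorient A Y).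
  case/(om_incomparable hN XN YN) => [/(inv_inj (@sreorientK T A))|]; first by left.
  by rewrite -sreorient_opp => /(inv_inj (@sreorientK T A)); right.
move=> XN YN nXY; rewrite inE => /andP[eX eY].
have [||Z ZN [sZ cZ]] := @circuit_eliminate _ _ hN _ _ e XN YN.
- by rewrite -sreorient_opp => /(inv_inj (@sreorientK T A)).
- by rewrite -sreorient_opp agree_reorient /agree eX eY.
exists (sreorient A Z); first by rewrite circuit_reorient sreorientK.
have cZ' D x : agree D (sreorient A Z) x -> agree D X x || agree D Y x.
  rewrite -[D](sreorientK A) agree_reorient => /cZ.
  rewrite -[X in agree _ X _ || _](sreorientK A) -[X in _ || agree _ X _](sreorientK A).
  by rewrite !agree_reorient !sreorientK.
have Ze x : x \in supp (sreorient A Z) -> x != e.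
  by rewrite supp_reorient => /(subsetP sZ); rewrite in_setD1 => /andP[].
split; apply/subsetP => x xZ; rewrite in_setD1 in_setU Ze ?in_supp ?xZ ?orbT //=.
  by have := cZ' ([set x], set0) x; rewrite /agree xZ !inE eqxx !orbF; apply.
by have := cZ' (set0, [set x]) x; rewrite /agree xZ !inE eqxx; apply.
Qed.

End Reorientation.

Section Signatures.
Variable T : finType.
Implicit Types (X Y Z C D : signed T) (x y e b u v f g : T) (A B S : {set T}).
Implicit Types (F : {set signed T}) (M N : omdata T).

Lemma signatureP F F' x X : (forall Y, Y \in F -> sopp Y \in F) ->
  (forall Y, Y \in F' -> sopp Y \in F') -> X \in F ->
  (exists2 Y, Y \in F' & srem x Y = X /\ x \in supp Y) ->
  let s := signature F F' x (supp X) in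
  [/\ s \in F, supp s = supp X & exists2 Y, Y \in F' & srem x Y = s /\ x \in Y.1].
Proof.
move=> oF oF' XF [Y YF' [YX xY]] s; rewrite /s /signature.
case: pickP => [Z /and3P[ZF /eqP sZ /exists_inP[W WF' /andP[/eqP WZ xW]]]|no].
  by split=> //; exists W.
move: xY; rewrite in_supp => /orP[xY|xY].
  have /negP[] := no X; rewrite XF eqxx; apply/exists_inP.
  by exists Y; rewrite ?YX ?eqxx.
have /negP[] := no (sopp X); rewrite oF // supp_opp eqxx; apply/exists_inP.
by exists (sopp Y); rewrite ?oF' // srem_opp YX eqxx.
Qed.

(** The pair [(S, [set h])] is positive on [S] and negative on the new element
    [h]; this is the shape of the two signed sets that encode an orientation
    defined by a basis. *)
Lemma sreorient_pair X S h A : [disjoint X.1 & X.2] -> supp X = h |: S ->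
  h \in X.2 -> h \notin S -> h \notin A ->
  (forall x, x \in S -> (x \in X.2) = (x \in A)) -> X = sreorient A (S, [set h]).
Proof.
move=> dX sX hX hS hA XA.
have main x : ((x \in X.1) = (if x \in A then x \in [set h] else x \in S)) *
              ((x \in X.2) = (if x \in A then x \in S else x \in [set h])).
  have := in_supp X x; rewrite sX in_setU1 in_set1.
  have [->|xh] := eqVneq x h; first by rewrite hX (disjointFl dX hX) (negbTE hA) (negbTE hS).
  case xS: (x \in S) => /=; last first.
    by case: (x \in X.1) => //; case: (x \in X.2) => //; rewrite if_same.
  rewrite -XA //; case x2: (x \in X.2); last by rewrite orbF => <-.
  by rewrite (disjointFl dX x2).
by apply: signed_eq => x; rewrite in_sreorient main.
Qed.

Lemma basis_exists M : oriented_matroid M -> exists B, B \in bases M.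
Proof.
move=> hM; have [|B BM _] := @independent_extend _ M set0; last by exists B.
rewrite /independent sub0set; apply/forall_inP => X XM.
rewrite subset0; apply: contraTneq XM => X0.
have -> : X = szero T; last exact: om_nonzero.
have X0x x : (x \in X.1 = false) * (x \in X.2 = false).
  by have := in_set0 x; rewrite -X0 in_supp => /negbT/norP[/negbTE-> /negbTE->].
by apply: signed_eq => x; rewrite X0x in_set0.
Qed.

Lemma circuit_delete N f X :
  (X \in circuits (delete N f)) = (X \in circuits N) && (f \notin supp X).
Proof. by rewrite inE. Qed.

Lemma delete_cocircuit N f Y B b :
  oriented_matroid (delete N f) ->
  B \in bases (delete N f) -> Y \in cocircuits N -> supp Y :&: B = [set b] ->
  srem f Y \in cocircuits (delete N f).
Proof.
move=> hM BM YN YB.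
have fB : f \notin B by apply/negP => /(subsetP (basis_ground BM)); rewrite in_setD1 eqxx.
apply: (cocircuit_intro hM _ _ _ BM (b := b)).
- exact: disjointWl (subsetDl _ _) (disjointWr (subsetDl _ _) (cocircuit_disjoint YN)).
- by rewrite supp_srem setSD // (cocircuit_ground YN).
- move=> C; rewrite circuit_delete => /andP[CN fC].
  by rewrite orthogonal_sym orthogonal_srem // orthogonal_sym (cocircuit_orthogonal YN CN).
rewrite supp_srem -YB; apply/setP => x; rewrite !in_setI in_setD1.
by have [->|] := eqVneq x f; rewrite // (negbTE fB) !andbF.
Qed.

Section Extension.
Variables (M N : omdata T) (f : T).
Hypotheses (hM : oriented_matroid M) (ext : generic_extension M N f).

Lemma ext_oriented_matroid : oriented_matroid N. Proof. by case: ext. Qed.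
Let hN := ext_oriented_matroid.

Lemma ext_circuit X : (X \in circuits M) = (X \in circuits N) && (f \notin supp X).
Proof. by case: ext => _ _ _ <- _; rewrite circuit_delete. Qed.

Lemma ext_notin B : B \in bases M -> f \notin B.
Proof.
by move=> BM; case: ext => + _ _ _ _; apply: contra; apply: (subsetP (basis_ground BM)).
Qed.

Lemma ext_new_circuit B : B \in bases M -> exists2 X, X \in circuits N & supp X = f |: B.
Proof.
move=> BM; case: ext => _ _ _ _ E.
have := imset_f (fun B => f |: B) BM; rewrite -E => /imsetP[X].
by rewrite inE => /andP[XN _] ->; exists X.
Qed.

Lemma ext_basis B : B \in bases M -> B \in bases N.
Proof.
move=> BM; have fB := ext_notin BM; have /basesP[sB iB cB] := BM.
have [_ _ gN _ _] := ext.
apply/basesP; split.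
- by rewrite gN; apply: subset_trans sB (subsetUr _ _).
- move=> X XN; have [fX|fX] := boolP (f \in supp X).
    by apply: contra fB => /subsetP; apply.
  by apply: iB; rewrite ext_circuit XN.
move=> x; rewrite gN in_setU1 => /predU1P[-> _|xM xB].
  by have [X XN sX] := ext_new_circuit BM; exists X; rewrite ?sX.
by have [X] := cB x xM xB; rewrite ext_circuit => /andP[XN _]; exists X.
Qed.

Lemma ext_basisE B : (B \in bases M) = (f \notin B) && (B \in bases N).
Proof.
apply/idP/andP => [BM|[fB BN]]; first by rewrite ext_notin // ext_basis.
have [_ _ gN _ _] := ext; have /basesP[sB iB cB] := BN.
apply/basesP; split.
- apply/subsetP => x xB; have := subsetP sB x xB; rewrite gN in_setU1.
  by case/predU1P => // xf; rewrite xf (negbTE fB) in xB.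
- by move=> X; rewrite ext_circuit => /andP[XN _]; apply: iB.
move=> x xM xB; have xf : x != f by case: ext => fM _ _ _ _; apply: contraNneq fM => <-.
have [|X XN sX] := cB x _ xB; first by rewrite gN in_setU1 xM orbT.
exists X => //; rewrite ext_circuit XN; apply/negP => /(subsetP sX).
by rewrite in_setU1 eq_sym (negbTE xf) (negbTE fB).
Qed.

(** Without [f], [Y] would meet the circuit on [f |: B] in [b] alone. *)
Lemma ext_cocircuit_new Y B b : B \in bases M -> Y \in cocircuits N ->
  supp Y :&: B = [set b] -> f \in supp Y.
Proof.
move=> BM YN YB; have [X XN sX] := ext_new_circuit BM.
have [bY bB] : b \in supp Y /\ b \in B.
  by have := set11 b; rewrite -YB in_setI => /andP[].
apply: contraT => fY; suff : b \notin supp X by rewrite sX in_setU1 bB orbT.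
apply: (orthogonal_single (cocircuit_disjoint YN) (circuit_disjoint hN XN)) => //.
  exact: cocircuit_orthogonal YN XN.
rewrite sX -YB; apply/subsetP => x; rewrite !in_setI => /andP[xY].
by rewrite in_setU1 xY => /predU1P[xf|//]; rewrite -xf xY in fY.
Qed.

Lemma ext_cocircuit_restrict Y B b : B \in bases M -> Y \in cocircuits N ->
  supp Y :&: B = [set b] -> srem f Y \in cocircuits M.
Proof.
move: hM; case: ext => _ _ _ <- _ hM' BM YN YB.
exact: delete_cocircuit BM YN YB.
Qed.

(** The fundamental cocircuit of [N] for a basis of [M] that meets [X] in one
    element restricts to [X], up to sign. *)
Lemma ext_cocircuit_lift X : X \in cocircuits M ->
  exists2 Y, Y \in cocircuits N & srem f Y = X /\ f \in supp Y.
Proof.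
move=> XM; have [B0 B0M] := basis_exists hM.
have [b bX _] := cocircuit_meets XM B0M.
have [B BM XB] := cocircuit_basis XM bX.
have bB : b \in B by have := set11 b; rewrite -XB in_setI => /andP[].
have [Y YN [YB _]] := fund_cocircuit_exists hN (ext_basis BM) bB.
have fY := ext_cocircuit_new BM YN YB.
have RYB : supp (srem f Y) :&: B = [set b].
  rewrite supp_srem -YB; apply/setP => x; rewrite !in_setI in_setD1.
  by have [->|] := eqVneq x f; rewrite // (negbTE (ext_notin BM)) !andbF.
have [->|->] := cocircuit_uniq hM XM (ext_cocircuit_restrict BM YN YB) BM XB RYB.
  by exists Y.
by exists (sopp Y); rewrite ?cocircuit_opp ?supp_opp.
Qed.

Lemma extension_signatureP X : X \in cocircuits M ->
  let s := extension_signature M N f (supp X) in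
  [/\ s \in cocircuits M, supp s = supp X &
      exists2 Y, Y \in cocircuits N & srem f Y = s /\ f \in Y.1].
Proof.
move=> XM; apply: signatureP => //; try by move=> Y; rewrite cocircuit_opp.
exact: ext_cocircuit_lift.
Qed.

End Extension.

Section Lifting.
Variables (M N : omdata T) (g : T).
Hypotheses (hM : oriented_matroid M) (lift : generic_lifting M N g).

Lemma lift_oriented_matroid : oriented_matroid N. Proof. by case: lift. Qed.
Let hN := lift_oriented_matroid.

Lemma lift_new_cocircuit B : B \in bases M ->
  exists2 Y, Y \in cocircuits N & supp Y = g |: (ground M :\: B).
Proof.
move=> BM; case: lift => _ _ _ _ E.
have := imset_f (fun B => g |: (ground M :\: B)) BM; rewrite -E => /imsetP[Y].
by rewrite inE => /andP[YN _] ->; exists Y.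
Qed.

(** [X] is the trace of a circuit [W] of [N], and the point is that [W] contains
    [g]. If [e] is in [X] and the basis [B] contains the rest of [X], then without
    [g] the circuit [W] would meet the cocircuit on [g |: (ground M :\: B)] in [e]
    alone. *)
Lemma lift_circuit X : X \in circuits M ->
  exists2 W, W \in circuits N & srem g W = X /\ g \in supp W.
Proof.
move=> XM; have /imsetP[W WN XW] : X \in [set srem g X | X in circuits N].
  by move: XM; case: lift => _ _ _ <- _; rewrite inE => /andP[].
exists W => //; split=> //.
have /set0Pn[e eX] : supp X != set0.
  have [B BM] := basis_exists hM; apply: contra (basis_indep BM XM) => /eqP->.
  exact: sub0set.
have [|B BM sB] := @independent_extend _ M (supp X :\ e).
  rewrite /independent; apply/andP; split.
    exact: subset_trans (subsetDl _ _) (circuit_ground hM XM).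
  apply/forall_inP => Y YM; apply/negP => sY.
  have E : supp Y = supp X.
    have sYX := subset_trans sY (subsetDl _ _).
    by case: (om_incomparable hM YM XM sYX) => ->; rewrite ?supp_opp.
  by have := subsetP sY e; rewrite E eX setD11 => /(_ isT).
have eB : e \notin B.
  apply: contra (basis_indep BM XM) => eB; apply/subsetP => x xX.
  by have [->|xe] := eqVneq x e; rewrite // (subsetP sB) // in_setD1 xe.
have [Y YN sY] := lift_new_cocircuit BM.
have eM := subsetP (circuit_ground hM XM) e eX.
have : e \in supp X by []; rewrite XW supp_srem in_setD1 => /andP[eg eW].
apply: contraT => gW; suff : e \notin supp W by rewrite eW.
apply: (orthogonal_single (cocircuit_disjoint YN) (circuit_disjoint hN WN)).
- exact: cocircuit_orthogonal YN WN.
- apply/subsetP => x; rewrite in_setI => /andP[xY xW]; rewrite in_set1.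
  have xg : x != g by apply: contraNneq gW => <-.
  move: xY; rewrite sY in_setU1 (negbTE xg) in_setD /= => /andP[xB _].
  apply: contraNT xB => xe; apply: (subsetP sB).
  by rewrite in_setD1 xe XW supp_srem in_setD1 xg.
by rewrite sY in_setU1 in_setD eB eM orbT.
Qed.

Lemma lifting_signatureP X : X \in circuits M ->
  let s := lifting_signature M N g (supp X) in
  [/\ s \in circuits M, supp s = supp X &
      exists2 W, W \in circuits N & srem g W = s /\ g \in W.1].
Proof.
move=> XM; apply: signatureP => //.
- by move=> Y; rewrite (circuit_opp hM).
- by move=> Y; rewrite (circuit_opp hN).
exact: lift_circuit.
Qed.

End Lifting.

End Signatures.

(** * Counting compatible reorientations by deletion and contraction *)

Section Counting.
Variable T : finType.
Implicit Types (C D Z : signed T) (e x y z : T) (A B S X Y : {set T}).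
Implicit Types (F : {set signed T}) (q : pred (signed T)).

(** [X] is deleted and [Y] contracted: with [F] the cocircuits of [M], the [D] in
    [F] disjoint from [Y] and nonnegative outside [X] are the ones that restrict
    to nonnegative covectors of the minor, reoriented along [A]. For circuits the
    roles of [X] and [Y] are interchanged. *)
Definition forced F q X Y A : bool :=
  [forall D in F, [disjoint supp D & Y] && ((sreorient A D).2 \subset X) ==> q D].

Lemma forcedP F q X Y A : reflect
  (forall D, D \in F -> [disjoint supp D & Y] -> (sreorient A D).2 \subset X -> q D)
  (forced F q X Y A).
Proof.
apply: (iffP forall_inP) => [h D DF dD sD|h D DF]; last by apply/implyP => /andP[]; exact: h.
by have := h D DF; rewrite dD sD.
Qed.

Lemma disjoint_setU1l e S Y : [disjoint e |: S & Y] = (e \notin Y) && [disjoint S & Y].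
Proof. by rewrite -disjointU1; apply: eq_disjoint => x; rewrite !inE. Qed.

Lemma disjoint_setU1r e S Y : [disjoint S & e |: Y] = (e \notin S) && [disjoint S & Y].
Proof. by rewrite !(disjoint_sym S) disjoint_setU1l. Qed.

Lemma setD1_notin e A : e \notin A -> A :\ e = A.
Proof.
move=> eA; apply/setP => x; rewrite in_setD1.
by have [->|] := eqVneq x e; rewrite //= (negbTE eA).
Qed.

Lemma in_reorient_minus A D e x : x != e ->
  (x \in (sreorient (A :\ e) D).2) = (x \in (sreorient A D).2).
Proof. by move=> xe; rewrite !in_sreorient in_setD1 xe. Qed.

Lemma in_reorient_plus A D e x : x != e ->
  (x \in (sreorient (e |: A) D).2) = (x \in (sreorient A D).2).
Proof. by move=> xe; rewrite !in_sreorient in_setU1 (negbTE xe). Qed.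

Lemma negative_supp A D x : x \in (sreorient A D).2 -> x \in supp D.
Proof. by rewrite -(supp_reorient A) in_supp => ->; rewrite orbT. Qed.

Lemma forced_avoid F q X Y A e : forced F q X Y A -> forced F q X (e |: Y) (A :\ e).
Proof.
move=> /forcedP h; apply/forcedP => D DF; rewrite disjoint_setU1r => /andP[eD dD] /subsetP sD.
apply: h => //; apply/subsetP => x xD; apply: sD; rewrite in_reorient_minus //.
by apply: contraNneq eD => <-; exact: negative_supp xD.
Qed.

Lemma forced_fail F q X Y A e : forced F q X Y A -> ~~ forced F q (e |: X) Y (A :\ e) ->
  exists2 D, D \in F & [/\ [disjoint supp D & Y], (sreorient A D).2 \subset e |: X &
    e \in (sreorient A D).2].
Proof.
move=> /forcedP h /forall_inPn[D DF]; rewrite negb_imply => /andP[/andP[dD /subsetP sD] nq].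
exists D => //; split=> //.
  apply/subsetP => x xD; have [->|xe] := eqVneq x e; first exact: setU11.
  by apply: sD; rewrite in_reorient_minus.
apply: contraNT nq => eD; apply: h => //; apply/subsetP => x xD.
have xe : x != e by apply: contraNneq eD => <-.
by have := sD x; rewrite in_reorient_minus // in_setU1 (negbTE xe) => /(_ xD).
Qed.

Lemma forced_both F q X Y A e : (forall D, D \in F -> [disjoint D.1 & D.2]) ->
  e \notin A -> forced F q X Y A -> forced F q X Y (e |: A) -> forced F q (e |: X) Y A.
Proof.
move=> dF eA /forcedP h /forcedP he; apply/forcedP => D DF dD /subsetP sD.
have [eD|eD] := boolP (e \in (sreorient A D).2); last first.
  apply: h => //; apply/subsetP => x xD; have := sD x xD.
  have /negbTE xe : x != e by apply: contraNneq eD => <-.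
  by rewrite in_setU1 xe.
apply: he => //; apply/subsetP => x xD.
have xe : x != e.
  apply: contraTneq xD => ->; rewrite in_sreorient setU11.
  by move: eD; rewrite in_sreorient (negbTE eA) => /(disjointFl (dF D DF)) ->.
by have := sD x; rewrite -(in_reorient_plus A D xe) in_setU1 (negbTE xe) => /(_ xD).
Qed.

Lemma forced_contra F q X Y A D : (forall Z, Z \in F -> q Z -> ~~ q (sopp Z)) ->
  forced F q X Y A -> D \in F -> sopp D \in F -> supp D \subset X ->
  ~~ [disjoint supp D & Y].
Proof.
move=> nq /forcedP h DF oDF sD; apply/negP => dD.
have sn Z : supp Z = supp D -> (sreorient A Z).2 \subset X.
  by move=> ZD; apply/subsetP => x /negative_supp; rewrite ZD; apply: (subsetP sD).
have /negP[] := nq D DF (h D DF dD (sn _ (erefl _))).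
by apply: h; rewrite ?sn ?supp_opp.
Qed.

Variables (M : omdata T) (p q : pred (signed T)).
Hypothesis hM : oriented_matroid M.
Hypothesis np : forall C, C \in circuits M -> p C -> ~~ p (sopp C).
Hypothesis nq : forall D, D \in cocircuits M -> q D -> ~~ q (sopp D).

(** Compatibility for the minor with [X] deleted and [Y] contracted, stated inside
    [M] so that no minor and no extension of a minor has to be formed. *)
Definition state X Y A :=
  forced (cocircuits M) q X Y A && forced (circuits M) p Y X A.

Definition states X Y := [set A in powerset (ground M :\: (X :|: Y)) | state X Y A].

Lemma in_states X Y A :
  (A \in states X Y) = (A \subset ground M :\: (X :|: Y)) && state X Y A.
Proof. by rewrite inE powersetE. Qed.

Definition bases_between X Y := [set B in bases M | (Y \subset B) && [disjoint B & X]].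

(** If both fail, a cocircuit and a circuit are negative on [e] and positive
    on the rest of their intersection; they agree everywhere they meet. *)
Lemma state_delete_or_contract X Y A e : state X Y A ->
  state (e |: X) Y (A :\ e) || state X (e |: Y) (A :\ e).
Proof.
move=> /andP[hD hC]; rewrite /state (forced_avoid e hD) (forced_avoid e hC) /= andbT.
apply: contraT; rewrite negb_or.
case/andP => /(forced_fail hD)[D DM [dD /subsetP sD eD]].
case/(forced_fail hC) => [C CM [dC /subsetP sC eC]].
have : agree (sreorient A D) (sreorient A C) e by rewrite /agree eD eC orbT.
case/orthogonal_disagree => [|z].
  by rewrite orthogonal_reorient (cocircuit_orthogonal DM CM).
have dD' := disjoint_reorient A (cocircuit_disjoint DM).
have dC' := disjoint_reorient A (circuit_disjoint hM CM).
move=> az; have /andP[] := agree_supp az; rewrite supp_opp !supp_reorient => zD zC.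
case/orP: az => /andP[z1 z2].
  have := sC z z2; rewrite in_setU1 (disjointFr dD zD) orbF => /eqP ze.
  by move: z1; rewrite ze (disjointFl dD' eD).
have := sD z z1; rewrite in_setU1 (disjointFr dC zC) orbF => /eqP ze.
by move: z2; rewrite ze /= (disjointFl dC' eC).
Qed.

(** A cocircuit or circuit that obstructs after deleting or contracting [e],
    whatever its sign on [e], already obstructs one of the two states. *)
Lemma state_delete_and_contract X Y A e : e \notin A -> state X Y A ->
  state X Y (e |: A) -> state (e |: X) Y A && state X (e |: Y) A.
Proof.
move=> eA /andP[hD hC] /andP[hDe hCe].
have := forced_avoid e hD; have := forced_avoid e hC; rewrite setD1_notin // /state => -> ->.
rewrite (forced_both _ eA hD hDe) ?(forced_both _ eA hC hCe) //.
  by move=> C; apply: circuit_disjoint.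
by move=> D; apply: cocircuit_disjoint.
Qed.

(** Nothing is left to reorient, so a circuit inside [Y] or a cocircuit inside
    [X] would be forced together with its opposite. *)
Lemma state_basis X Y A : Y \subset ground M -> ground M \subset X :|: Y ->
  [disjoint X & Y] -> state X Y A -> Y \in bases M.
Proof.
move=> sY sXY dXY /andP[hD hC].
apply: (independent_meets_basis hM).
  rewrite /independent sY; apply/forall_inP => C CM; apply/negP => sC.
  have := forced_contra np hC CM; rewrite circuit_opp // => /(_ CM sC) /negP[].
  by rewrite disjoint_sym; apply: disjointWr sC dXY.
move=> D DM; rewrite setI_eq0; apply/negP => dD.
have := forced_contra nq hD DM; rewrite cocircuit_opp // dD => /(_ DM) h.
suff /h : supp D \subset X by [].
apply/subsetP => x xD; have := subsetP sXY x (subsetP (cocircuit_ground DM) x xD).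
by rewrite in_setU (disjointFr dD xD) orbF.
Qed.

(** Deletion-contraction of an element [e]. A set [A] without [e] accounts for the
    one or two states among [A] and [e |: A], and it is a state of the deletion
    or of the contraction, and of both if both sets are states. Bases split
    exactly, by whether they contain [e]. *)
Lemma states_le_bases X Y : X \subset ground M -> Y \subset ground M ->
  [disjoint X & Y] -> #|states X Y| <= #|bases_between X Y|.
Proof.
have [n] := ubnP #|ground M :\: (X :|: Y)|.
elim: n X Y => // n IHn X Y; rewrite ltnS => leXYn sX sY dXY.
have [R0|[e eR]] := set_0Vmem (ground M :\: (X :|: Y)).
  have [->|[A]] := set_0Vmem (states X Y); first by rewrite cards0.
  rewrite in_states => /andP[_ AXY].
  apply: (@leq_trans 1).
    rewrite -(cards1 (set0 : {set T})); apply/subset_leq_card/subsetP => A'.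
    by rewrite in_states R0 subset0 in_set1 => /andP[].
  have YM : Y \in bases M.
    by apply: (state_basis sY _ dXY AXY); rewrite -setD_eq0 R0.
  rewrite card_gt0; apply/set0Pn; exists Y.
  by rewrite inE YM subxx disjoint_sym.
have [eM eX eY] : [/\ e \in ground M, e \notin X & e \notin Y].
  by move: eR; rewrite !inE negb_or => /andP[/andP[-> ->] ->].
have Rx : ground M :\: ((e |: X) :|: Y) = (ground M :\: (X :|: Y)) :\ e.
  by rewrite -setUA setUC -setDDl.
have Ry : ground M :\: (X :|: (e |: Y)) = (ground M :\: (X :|: Y)) :\ e.
  by rewrite setUCA setUC -setDDl.
have ltR : #|(ground M :\: (X :|: Y)) :\ e| < n.
  by apply: leq_trans leXYn; rewrite [leqRHS](cardsD1 e) eR.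
pose S0 := [set A in states X Y | e \notin A].
pose S1 := [set A :\ e | A in [set A in states X Y | e \in A]].
have S1P A : A \in S1 -> e \notin A /\ e |: A \in states X Y.
  by case/imsetP => A1; rewrite inE => /andP[A1S eA1] ->; rewrite setD11 setD1K.
have -> : #|states X Y| = #|S0| + #|S1|.
  rewrite -(cardsID [set A : {set T} | e \in A]) addnC; congr (_ + _).
    by apply: eq_card => A; rewrite !inE andbC.
  rewrite card_in_imset => [|A1 A2]; first by apply: eq_card => A; rewrite !inE.
  by rewrite !inE => /andP[_ eA1] /andP[_ eA2] E; rewrite -(setD1K eA1) E setD1K.
have sub : #|S0| + #|S1| <= #|states (e |: X) Y| + #|states X (e |: Y)|.
  rewrite -cardsUI -[in leqRHS]cardsUI; apply: leq_add; apply: subset_leq_card.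
    have main A : A \in states X Y ->
        A :\ e \in states (e |: X) Y :|: states X (e |: Y).
      rewrite in_setU !in_states Rx Ry => /andP[sA /(state_delete_or_contract e)].
      by rewrite setSD.
    apply/subsetP => A; rewrite in_setU => /orP[|/imsetP[A1]]; rewrite inE => /andP[AS eA].
      by rewrite -(setD1_notin eA) main.
    by move=> ->; exact: main.
  apply/subsetP => A; rewrite in_setI inE => /andP[/andP[AS eA] /S1P[_ eAS]].
  move: AS eAS; rewrite !in_states => /andP[sA AXY] /andP[_ eAXY].
  have sAe : A \subset (ground M :\: (X :|: Y)) :\ e by rewrite subsetD1 sA.
  have /andP[Ax Ay] := state_delete_and_contract eA AXY eAXY.
  by rewrite in_setI !in_states Rx Ry sAe Ax Ay.
apply: leq_trans sub _.
have -> : #|bases_between X Y| = #|bases_between (e |: X) Y| + #|bases_between X (e |: Y)|.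
  rewrite -(cardsID [set B : {set T} | e \in B]) addnC; congr (_ + _); apply: eq_card => B;
  by rewrite !inE ?disjoint_setU1r ?subUset ?sub1set; case: (e \in B);
     rewrite ?andbT ?andbF //= andbT.
apply: leq_add; apply: IHn; rewrite ?Rx ?Ry // ?subUset ?sub1set ?eM //.
  by rewrite disjoint_setU1l eY.
by rewrite disjoint_setU1r eX.
Qed.

End Counting.

(** * The bijection between bases and compatible reorientations *)

Section Bijection.
Variables (T : finType) (M N' N'' : omdata T) (f g : T).
Hypotheses (hM : oriented_matroid M).
Hypotheses (ext : generic_extension M N' f) (lift : generic_lifting M N'' g).
Implicit Types (X Y Z C D W : signed T) (x y e b u v : T) (A B S : {set T}).

Let hN' := ext_oriented_matroid ext.
Let hN'' := lift_oriented_matroid lift.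

Let O := orientation_of_basis M (extension_signature M N' f) (lifting_signature M N'' g).

Lemma orientation_ground B : O B \subset ground M.
Proof. by apply/subsetP => x; rewrite inE => /andP[]. Qed.

Lemma new_notin A : A \subset ground M -> f \notin A /\ g \notin A.
Proof.
move=> sA; case: ext => fM _ _ _ _; case: lift => gM _ _ _ _.
by split; [apply: contra fM | apply: contra gM]; apply: (subsetP sA).
Qed.

Lemma orientation_sign_in B b : B \in bases M -> b \in B ->
  exists2 Y, Y \in cocircuits N' &
    [/\ f \in Y.1, srem f Y \in cocircuits M, supp Y :&: B = [set b] &
        (b \in O B) = (b \in Y.2)].
Proof.
move=> BM bB; have [DM DB _] := fund_cocircuitP hM BM bB.
have [sM ss [Y YN [Ys fY]]] := extension_signatureP hM ext DM.
have [fB _] := new_notin (basis_ground BM).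
have bf : b != f by apply: contraNneq fB => <-.
exists Y => //; split=> //; first by rewrite Ys.
  rewrite -DB -ss -Ys supp_srem; apply/setP => x; rewrite !in_setI in_setD1.
  by have [->|] := eqVneq x f; rewrite // (negbTE fB) !andbF.
by rewrite inE (subsetP (basis_ground BM)) // bB -Ys inE in_set1 bf.
Qed.

Lemma orientation_sign_out B e : B \in bases M -> e \in ground M -> e \notin B ->
  exists2 W, W \in circuits N'' &
    [/\ g \in W.1, supp W \subset g |: (e |: B), e \in supp W &
        (e \in O B) = (e \in W.2)].
Proof.
move=> BM eM eB; have [CM sC eC] := fund_circuitP hM BM eM eB.
have [sM ss [W WN [Ws gW]]] := lifting_signatureP hM lift CM.
have [_ gM] := new_notin (subxx _).
have eg : e != g by apply: contraNneq gM => <-.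
have sW : supp W :\ g = supp (fund_circuit M B e) by rewrite -supp_srem Ws.
exists W => //; split=> //.
- by rewrite -subDset sW.
- have : e \in supp W :\ g by rewrite sW in_supp eC.
  by rewrite in_setD1 => /andP[].
by rewrite inE eM (negbTE eB) -Ws inE in_set1 eg.
Qed.

(** In the circuit of [N'] supported by [B] and [f], each [b] in [B] has the sign
    dictated by the cocircuit that defines [b \in O B], as the two meet in [b]
    and [f] only. *)
Lemma orientation_circuit B : B \in bases M ->
  sreorient (O B) (B, [set f]) \in circuits N'.
Proof.
move=> BM; have [fB _] := new_notin (basis_ground BM).
have [fO _] := new_notin (orientation_ground B).
have [X [XN sX fX]] : exists X, [/\ X \in circuits N', supp X = f |: B & f \in X.2].
  have [X XN sX] := ext_new_circuit ext BM.
  have : f \in supp X by rewrite sX setU11.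
  rewrite in_supp => /orP[fX|fX]; last by exists X.
  by exists (sopp X); rewrite circuit_opp ?supp_opp.
have dX := circuit_disjoint hN' XN.
suff <- : X = sreorient (O B) (B, [set f]) by [].
apply: sreorient_pair => // b bB.
have [Y YN [fY _ YB ->]] := orientation_sign_in BM bB.
have dY := cocircuit_disjoint YN.
have [fYs fXs] : f \in supp Y /\ f \in supp X by rewrite !in_supp fY fX orbT.
have bXs : b \in supp X by rewrite sX in_setU1 bB orbT.
have bYs : b \in supp Y by have := set11 b; rewrite -YB in_setI => /andP[].
have sXY : supp Y :&: supp X \subset [set f; b].
  by rewrite setUC; apply: meet_fund YB _; rewrite sX.
have nb : agree Y (sopp X) b = false.
  rewrite (orthogonal_pairE dY dX (cocircuit_orthogonal YN XN) sXY) //.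
  by rewrite /agree fY fX (disjointFl dX fX) (disjointFr dY fY).
have := agree_or bYs bXs; rewrite nb orbF => /(agree_eq dY dX) E.
by rewrite E.
Qed.

(** Dual to [orientation_circuit], with the circuit that defines [e \in O B]. *)
Lemma orientation_cocircuit B : B \in bases M ->
  sreorient (O B) (ground M :\: B, [set g]) \in cocircuits N''.
Proof.
move=> BM; have [_ gM] := new_notin (subxx _).
have [_ gO] := new_notin (orientation_ground B).
have [Z [ZN sZ gZ]] : exists Z, [/\ Z \in cocircuits N'',
    supp Z = g |: (ground M :\: B) & g \in Z.2].
  have [Z ZN sZ] := lift_new_cocircuit lift BM.
  have : g \in supp Z by rewrite sZ setU11.
  rewrite in_supp => /orP[gZ|gZ]; last by exists Z.
  by exists (sopp Z); rewrite cocircuit_opp ?supp_opp.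
have dZ := cocircuit_disjoint ZN.
suff <- : Z = sreorient (O B) (ground M :\: B, [set g]) by [].
apply: sreorient_pair => //; first by rewrite in_setD (negbTE gM) andbF.
move=> e; rewrite in_setD => /andP[eB eM].
have [W WN [gW sW eW ->]] := orientation_sign_out BM eM eB.
have dW := circuit_disjoint hN'' WN.
have [gZs gWs] : g \in supp Z /\ g \in supp W by rewrite !in_supp gZ gW orbT.
have eZs : e \in supp Z by rewrite sZ in_setU1 in_setD eB eM orbT.
have sZW : supp Z :&: supp W \subset [set g; e].
  apply/subsetP => x; rewrite in_setI sZ in_setU1 in_setD => /andP[xZ /(subsetP sW)].
  rewrite !in_setU1 in_set1 => /or3P[->|->|xB]; rewrite ?orbT //.
  by move: xZ; rewrite xB orbF => ->.
have ne : agree Z (sopp W) e = false.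
  rewrite (orthogonal_pairE dZ dW (cocircuit_orthogonal ZN WN) sZW) //.
  by rewrite /agree gZ gW (disjointFl dZ gZ) (disjointFr dW gW).
have := agree_or eZs eW; rewrite ne orbF => /(agree_eq dZ dW) E.
by rewrite E.
Qed.

(** Let [B1] and [B2] induce the same reorientation [A]. In [reorient A N'],
    eliminating [f] between the circuits (B2, -f) and -(B1, -f) gives a circuit
    [Z] of [reorient A M], positive part in [B2], negative part in [B1]. Lift it
    to a circuit [V] of [reorient A N'']. Outside [B1] it is positive, so
    orthogonality with the cocircuit (E - B1, -g) makes [V] positive on [g];
    outside [B2] it is negative, which makes [V] negative on [g]. *)
Lemma orientation_inj : {in bases M &, injective O}.
Proof.
move=> B1 B2 B1M B2M OB; apply/eqP; apply: contraT => nB.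
have := orientation_circuit B2M; have := orientation_circuit B1M.
have := orientation_cocircuit B2M; have := orientation_cocircuit B1M.
rewrite -OB -!cocircuit_reorient -!circuit_reorient.
set A := O B1 => Y1 Y2 X1 X2.
have hA := reorient_oriented_matroid A hN'.
have oX1 : sopp (B1, [set f]) \in circuits (reorient A N') by rewrite circuit_opp.
have [f1 _] := new_notin (basis_ground B1M).
have [f2 _] := new_notin (basis_ground B2M).
have [||Z ZN [/= sZ1 sZ2]] := om_elimination hA (e := f) oX1 X2.
- by move/(congr1 snd) => /= E; rewrite E eqxx in nB.
- by rewrite inE /= !set11.
have fZ : f \notin supp Z.
  rewrite in_supp; apply/negP => /orP[/(subsetP sZ1)|/(subsetP sZ2)];
  by rewrite in_setD1 eqxx.
have ZM : sreorient A Z \in circuits M.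
  by rewrite (ext_circuit ext) supp_reorient fZ andbT -circuit_reorient.
have Z1 x : x \in Z.1 -> x \in B2.
  by move/(subsetP sZ1); rewrite in_setD1 in_setU in_set1 => /andP[/negbTE->].
have Z2 x : x \in Z.2 -> x \in B1.
  by move/(subsetP sZ2); rewrite in_setD1 in_setU in_set1 orbC => /andP[/negbTE->].
have [W WN [WZ gW]] := lift_circuit hM lift ZM.
pose V := sreorient A W.
have VN : V \in circuits (reorient A N'') by rewrite circuit_reorient sreorientK.
have VZ : srem g V = Z by rewrite -sreorient_srem WZ sreorientK.
have hA'' := reorient_oriented_matroid A hN''.
have V12 x : x != g -> ((x \in V.1) = (x \in Z.1)) * ((x \in V.2) = (x \in Z.2)).
  by move=> xg; rewrite -VZ !inE xg.
have gV : g \in supp V by rewrite supp_reorient.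
have sZ B : B \in bases M -> exists x, [/\ x \in supp Z, x \notin B & x \in ground M].
  move=> BM; have /subsetPn[x] := basis_indep BM ZM; rewrite supp_reorient => xZ xB.
  exists x; split=> //; apply: (subsetP (circuit_ground hM ZM)).
  by rewrite supp_reorient.
have [_ gM] := new_notin (subxx _).
have dV := circuit_disjoint hA'' VN.
have g1 : g \in V.1.
  have [x [xZ xB xM]] := sZ B1 B1M.
  have xg : x != g by apply: contraNneq gM => <-.
  have x1 : x \in Z.1.
    by move: xZ; rewrite in_supp => /orP[//|/Z2]; rewrite (negbTE xB).
  have [||y] := @orthogonal_disagree _ (ground M :\: B1, [set g]) V x.
  - exact: cocircuit_orthogonal Y1 VN.
  - by rewrite /agree V12 // x1 in_setD xB xM.
  rewrite /agree /= in_setD in_set1 => /orP[/andP[/andP[yB yM]]|/andP[/eqP-> //]].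
  rewrite V12; first by move/Z2; rewrite (negbTE yB).
  by apply: contraNneq gM => <-.
have g2 : g \in V.2.
  have [x [xZ xB xM]] := sZ B2 B2M.
  have xg : x != g by apply: contraNneq gM => <-.
  have x1 : x \in Z.2.
    by move: xZ; rewrite in_supp => /orP[/Z1|//]; rewrite (negbTE xB).
  have [||y] := @orthogonal_agree _ (ground M :\: B2, [set g]) V x.
  - exact: cocircuit_orthogonal Y2 VN.
  - by rewrite /agree /= !V12 // x1 in_setD xB xM.
  rewrite /agree /= in_setD in_set1 => /orP[/andP[/andP[yB yM]]|/andP[/eqP-> //]].
  rewrite V12; first by move/Z1; rewrite (negbTE yB).
  by apply: contraNneq gM => <-.
by move: g2; rewrite (disjointFr dV g1).
Qed.

Let compat := compatible_reorientations M N' f N'' g.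

(** A positive cocircuit meets [B], so orthogonality with the circuit (B, -f)
    forces the sign on [f]; a positive circuit leaves [B], and the cocircuit
    (E - B, -g) forces the sign on [g]. *)
Lemma orientation_compatible B : B \in bases M -> O B \in compat.
Proof.
move=> BM; have := orientation_circuit BM; have := orientation_cocircuit BM.
rewrite -cocircuit_reorient -circuit_reorient => YN XN.
have [fB _] := new_notin (basis_ground BM).
have hA := reorient_oriented_matroid (O B) hM.
have BA : B \in bases (reorient (O B) M) by rewrite bases_reorient.
rewrite inE powersetE orientation_ground /=; apply/andP; split; apply/forall_inP => D DM.
  apply/implyP => /eqP D0; apply/forall_inP => Z ZN; apply/implyP => /andP[fZ /eqP ZD].
  have [x xD xB] := cocircuit_meets DM BA.
  have xf : x != f by apply: contraNneq fB => <-.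
  have x1 : x \in Z.1.
    by move: xD; rewrite in_supp D0 in_set0 orbF -ZD /= in_setD1 xf.
  have [||y] := @orthogonal_disagree _ Z (B, [set f]) x.
  - exact: cocircuit_orthogonal ZN XN.
  - by rewrite /agree x1 xB.
  rewrite /agree /= in_set1 => /orP[/andP[+ /eqP <-]//|/andP[y2 yB]].
  have yf : y != f by apply: contraNneq fB => <-.
  by have := in_set0 y; rewrite -D0 -ZD /= in_setD1 yf y2.
apply/implyP => /eqP D0; apply/forall_inP => Z ZN; apply/implyP => /andP[gZ /eqP ZD].
have [_ gM] := new_notin (subxx _).
have /subsetPn[x xD xB] := basis_indep BA DM.
have xM := subsetP (circuit_ground hA DM) x xD.
have xg : x != g by apply: contraNneq gM => <-.
have x1 : x \in Z.1.
  by move: xD; rewrite in_supp D0 in_set0 orbF -ZD /= in_setD1 xg.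
have [||y] := @orthogonal_disagree _ (ground M :\: B, [set g]) Z x.
- exact: cocircuit_orthogonal YN ZN.
- by rewrite /agree x1 in_setD xB xM.
rewrite /agree /= in_set1 in_setD => /orP[/andP[/andP[yB yM] y2]|/andP[/eqP->//]].
have yg : y != g by apply: contraNneq gM => <-.
by have := in_set0 y; rewrite -D0 -ZD /= in_setD1 yg y2.
Qed.

Definition lifts_positively (F : {set signed T}) x X :=
  [exists Y in F, (srem x Y == X) && (x \in Y.1)].

(** Otherwise the lifts of [X] and [sopp X] have the same support and the same
    sign on [x], hence coincide. *)
Lemma lifts_positively_opp (F : {set signed T}) x X :
  (forall Y Z, Y \in F -> Z \in F -> supp Y = supp Z -> Y = Z \/ Y = sopp Z) ->
  (forall Y, Y \in F -> [disjoint Y.1 & Y.2]) -> supp X != set0 -> [disjoint X.1 & X.2] ->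
  lifts_positively F x X -> ~~ lifts_positively F x (sopp X).
Proof.
move=> uF dF /set0Pn[e eX] dX /exists_inP[Y YF /andP[/eqP YX xY]].
apply/exists_inPn => Z ZF; apply/negP => /andP[/eqP ZX xZ].
have sYZ : supp Y = supp Z.
  apply/setP => y; have [->|yx] := eqVneq y x; first by rewrite !in_supp xY xZ.
  have : (y \in supp Y :\ x) = (y \in supp Z :\ x).
    by rewrite -!supp_srem YX ZX supp_opp.
  by rewrite !in_setD1 yx.
case: (uF Y Z YF ZF sYZ) => E; last first.
  by move: xY; rewrite E /= (disjointFr (dF Z ZF) xZ).
have XE : X = sopp X by rewrite -ZX -E YX.
have X12 : X.1 = X.2 by rewrite {1}XE.
by move: eX; rewrite in_supp -X12 orbb => e1; have := disjointFr dX e1; rewrite -X12 e1.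
Qed.

Lemma compatible_state A : A \in compat ->
  A \in states M (lifts_positively (circuits N'') g)
                 (lifts_positively (cocircuits N') f) set0 set0.
Proof.
rewrite inE powersetE => /andP[sA /andP[/forall_inP pD /forall_inP pC]].
rewrite in_states set0U setD0 sA /=.
apply/andP; split; apply/forcedP => D DM _; rewrite subset0 => D0.
  have [Y YN [YD fY]] := ext_cocircuit_lift hM ext DM.
  apply/exists_inP; exists Y => //; rewrite YD eqxx /=.
  have [fA _] := new_notin sA.
  have := pD (sreorient A D); rewrite cocircuit_reorient sreorientK => /(_ DM).
  move/implyP => /(_ D0)/forall_inP/(_ (sreorient A Y)).
  rewrite cocircuit_reorient sreorientK supp_reorient fY -sreorient_srem YD eqxx.
  by move=> /(_ YN); rewrite in_sreorient (negbTE fA).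
have [Y YN [YD gY]] := lift_circuit hM lift DM.
apply/exists_inP; exists Y => //; rewrite YD eqxx /=.
have [_ gA] := new_notin sA.
have := pC (sreorient A D); rewrite circuit_reorient sreorientK => /(_ DM).
move/implyP => /(_ D0)/forall_inP/(_ (sreorient A Y)).
rewrite circuit_reorient sreorientK supp_reorient gY -sreorient_srem YD eqxx.
by move=> /(_ YN); rewrite in_sreorient (negbTE gA).
Qed.

Lemma card_compatible : #|compat| <= #|bases M|.
Proof.
apply: (@leq_trans #|states M (lifts_positively (circuits N'') g)
                 (lifts_positively (cocircuits N') f) set0 set0|).
  exact/subset_leq_card/subsetP/compatible_state.
apply: leq_trans (states_le_bases hM _ _ (sub0set _) (sub0set _) _) _.
- move=> C CM; apply: lifts_positively_opp => //.
  + by move=> Y Z YN ZN E; apply: (om_incomparable hN'') => //; rewrite E.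
  + by move=> Y; apply: circuit_disjoint.
  + have [B BM] := basis_exists hM; apply: contra (basis_indep BM CM) => /eqP->.
    exact: sub0set.
  + exact: circuit_disjoint CM.
- have [B BM] := basis_exists hM.
  move=> D DM; apply: lifts_positively_opp => //.
  + move=> Y Z YN ZN E; have [B' B'N] := basis_exists hN'.
    have [x xY _] := cocircuit_meets YN B'N.
    have [B2 B2N YB] := cocircuit_basis YN xY.
    by apply: (cocircuit_uniq hN' YN ZN B2N YB); rewrite -E.
  + by move=> Y; apply: cocircuit_disjoint.
  + by have [x xD _] := cocircuit_meets DM BM; apply/set0Pn; exists x.
  + exact: cocircuit_disjoint DM.
- by rewrite -setI_eq0 set0I.
by apply/subset_leq_card/subsetP => B; rewrite inE => /andP[].
Qed.

Proposition orientation_bijection : bijection_between (bases M) compat O.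
Proof.
split; first exact: orientation_inj.
apply/eqP; rewrite eqEcard (card_in_imset orientation_inj) card_compatible andbT.
by apply/subsetP => _ /imsetP[B BM ->]; exact: orientation_compatible.
Qed.

End Bijection.

(** * Contractions and linear orders *)

Section Contraction.
Variables (T : finType) (N : omdata T) (g : T).
Hypotheses (hN : oriented_matroid N) (gN : g \in ground N) (gloop : ~~ loop N g).
Implicit Types (X Y Z C D W : signed T) (x y e b u v : T) (A B S : {set T}).

Lemma contract_circuit_lift X : X \in circuits (contract N g) ->
  exists2 Y, Y \in circuits N & srem g Y = X.
Proof. by rewrite inE => /andP[/imsetP[Y YN ->] _]; exists Y. Qed.

(** The nonempty trace of [Y] outside [g] contains a minimal one. *)
Lemma contract_circuit_sub Y S : Y \in circuits N -> supp Y \subset g |: S ->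
  exists2 X, X \in circuits (contract N g) & supp X \subset S.
Proof.
move=> YN sY; set F := [set srem g Z | Z in circuits N].
have YF : srem g Y \in F by apply: imset_f.
have Y0 : supp (srem g Y) != set0.
  rewrite supp_srem setD_eq0; apply: contra gloop; rewrite subset1 => /orP[E|/eqP/setP Y0].
    by apply/exists_inP; exists Y.
  have Y0x x : (x \in Y.1 = false) * (x \in Y.2 = false).
    by have := Y0 x; rewrite in_set0 in_supp => /negbT/norP[/negbTE-> /negbTE->].
  case/negP: (om_nonzero hN); have <- // : Y = szero T.
  by apply: signed_eq => x; rewrite Y0x in_set0.
have [|S0 mS0 sS0] := @minset_exists _
    (fun S : {set T} => (S != set0) && (S \in [set supp Z | Z in F])) (supp (srem g Y)).
  by rewrite Y0 imset_f.
have /andP[_ /imsetP[X XF XE]] := minsetp mS0.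
exists X; first by rewrite inE XF -XE.
by rewrite -XE; apply: subset_trans sS0 _; rewrite supp_srem subDset.
Qed.

Lemma contract_basisE B :
  (B \in bases (contract N g)) = (g \notin B) && (g |: B \in bases N).
Proof.
apply/basesP/andP => [[sB iB cB]|[gB /basesP[sB iB cB]]].
  have gB : g \notin B by apply/negP => /(subsetP sB); rewrite in_setD1 eqxx.
  split=> //; apply/basesP; split.
  - by rewrite subUset sub1set gN; apply: subset_trans sB (subsetDl _ _).
  - move=> Y YN; apply/negP => /(contract_circuit_sub YN)[X XN].
    by apply/negP; apply: iB.
  move=> x xN; rewrite in_setU1 negb_or => /andP[xg xB].
  have [|X /contract_circuit_lift[Y YN <-] sX] := cB x _ xB; first by rewrite in_setD1 xg.
  by exists Y; rewrite // setUCA -subDset -supp_srem.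
split.
- by rewrite subsetD1 gB andbT; apply: subset_trans (subsetUr _ _) sB.
- move=> X /contract_circuit_lift[Y YN <-]; rewrite supp_srem subDset.
  exact: iB.
move=> x; rewrite in_setD1 => /andP[xg xN] xB.
have [|Y YN] := cB x xN; first by rewrite in_setU1 negb_or xg.
rewrite setUCA => /(contract_circuit_sub YN)[X XN sX]; by exists X.
Qed.

Lemma contract_cocircuit Y B b : oriented_matroid (contract N g) ->
  B \in bases (contract N g) -> Y \in cocircuits N -> b \in B ->
  supp Y :&: (g |: B) = [set b] -> Y \in cocircuits (contract N g).
Proof.
move=> h1 BN1 YN bB YB; have := BN1; rewrite contract_basisE => /andP[gB _].
have gY : g \notin supp Y.
  apply: contra gB => gY; have /set1P -> // : g \in [set b].
  by rewrite -YB in_setI gY setU11.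
have YB1 : supp Y :&: B = [set b].
  rewrite -YB; apply/setP => x; rewrite !in_setI in_setU1.
  by have [->|] := eqVneq x g; rewrite // (negbTE gY).
apply: (cocircuit_intro h1 (cocircuit_disjoint YN) _ _ BN1 YB1).
  by rewrite subsetD1 gY andbT (cocircuit_ground YN).
move=> X /contract_circuit_lift[W WN <-].
by rewrite orthogonal_srem // (cocircuit_orthogonal YN WN).
Qed.

End Contraction.

Section Order.
Variable T : finType.
Implicit Types (X : signed T) (x y e m : T) (A S : {set T}) (le : rel T).

Lemma opposite_in_opp X x y : opposite_in (sopp X) x y = opposite_in X x y.
Proof. by rewrite /opposite_in orbC. Qed.

Lemma opposite_in_reorient A X x y : [disjoint X.1 & X.2] ->
  x \in supp X -> y \in supp X ->
  opposite_in (sreorient A X) x y = opposite_in X x y (+) (x \in A) (+) (y \in A).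
Proof.
move=> dX; have d z : ~~ ((z \in X.1) && (z \in X.2)).
  by apply/negP => /andP[z1]; rewrite (disjointFr dX z1).
have := d x; have := d y; rewrite !in_supp /opposite_in !in_sreorient.
by case: (x \in X.1); case: (y \in X.1); case: (x \in X.2); case: (y \in X.2);
  case: (x \in A); case: (y \in A).
Qed.

Lemma opposite_to_minE A le X e m : linear_order_on A le -> supp X \subset A ->
  is_min le (supp X) m -> opposite_to_min le X e = opposite_in X e m.
Proof.
case=> anti _ _ /subsetP sX mX; apply/existsP/idP => [[m' /andP[m'X]]|o].
  case/andP: mX m'X => mX /forall_inP lem /andP[m'X /forall_inP lem'].
  by rewrite (anti m m') ?sX // lem // lem'.
by exists m; rewrite mX.
Qed.

Lemma is_min_sub le A S m : is_min le A m -> S \subset A -> m \in S -> is_min le S m.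
Proof.
case/andP => _ /forall_inP lem /subsetP sSA mS; rewrite /is_min mS.
by apply/forall_inP => y /sSA/lem.
Qed.

Lemma reorient_reorient A A' (N : omdata T) : [disjoint A & A'] ->
  reorient A' (reorient A N) = reorient (A :|: A') N.
Proof.
move=> dAA'; congr OMData; apply/setP => X.
rewrite -[LHS]/(X \in circuits (reorient A' (reorient A N))).
rewrite -[RHS]/(X \in circuits (reorient (A :|: A') N)).
by rewrite !circuit_reorient sreorientD.
Qed.

End Order.

(** * Fully optimal bases of an extension-lifting *)

Section ExtensionLifting.
Variables (T : finType) (M N : omdata T) (f g : T) (le : rel T).
Hypotheses (hM : oriented_matroid M) (hN : oriented_matroid N) (hfg : f != g).
Hypothesis gN : ground N = f |: (g |: ground M).
Hypothesis gloop : ~~ loop N g.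
Hypotheses (ext1 : generic_extension M (contract N g) f)
           (lift1 : generic_lifting M (delete N f) g)
           (ext2 : generic_extension (delete N f) N f)
           (lift2 : generic_lifting (contract N g) N g).
Hypothesis cpl : compliant N f g.
Hypotheses (le_order : linear_order_on (ground N) le)
           (g_min : is_min le (ground N) g) (f_min : is_min le (ground N :\ g) f).
Implicit Types (X Y Z C D W F : signed T) (x y e b u v : T) (A B S : {set T}).

Let O := orientation_of_basis M (extension_signature M (contract N g) f)
                                (lifting_signature M (delete N f) g).

Let h1 := ext_oriented_matroid ext1.
Let h2 := lift_oriented_matroid lift1.

Local Notation R A := (reorient (A :|: [set f; g]) N).

Let g_ground : g \in ground N. Proof. by rewrite gN !in_setU1 eqxx orbT. Qed.

Let basisE B : (B \in bases M) = [&& f \notin B, g \notin B & g |: B \in bases N].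
Proof. by rewrite (ext_basisE ext1) contract_basisE. Qed.

Let contract_basis B : B \in bases M -> B \in bases (contract N g).
Proof. exact: (ext_basis ext1). Qed.

Let fgM A : A \subset ground M -> f \notin A /\ g \notin A.
Proof. exact: (new_notin ext1 lift1). Qed.

Let RA A x : x \in ground M -> (x \in A :|: [set f; g]) = (x \in A).
Proof.
have [fM gM] := fgM (subxx _).
move=> xM; rewrite in_setU in_set2.
have /negbTE-> : x != f by apply: contraNneq fM => <-.
have /negbTE-> : x != g by apply: contraNneq gM => <-.
by rewrite !orbF.
Qed.

(** The circuit of [delete N f] that defines [e \in O B] is, up to sign, the
    fundamental circuit of [e] for [g |: B] in [N]. Its smallest element is [g],
    which is reoriented in [R A]. *)
Lemma opposite_to_min_out A B e : A \subset ground M -> B \in bases M ->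
  e \in ground M -> e \notin B ->
  opposite_to_min le (fund_circuit (R A) (g |: B) e) e = ((e \in A) == (e \in O B)).
Proof.
move=> sA BM eM eB; have [fM gM] := fgM (subxx _).
have BN : g |: B \in bases N by have := BM; rewrite basisE => /and3P[].
have [W + [gW sW eW ->]] := orientation_sign_out hM ext1 lift1 BM eM eB.
rewrite circuit_delete => /andP[WN _]; rewrite setUCA in sW.
have hR : oriented_matroid (R A) by apply: reorient_oriented_matroid.
have BR : g |: B \in bases (R A) by rewrite bases_reorient.
have eg : e != g by apply: contraNneq gM => <-.
have [|//|FR sF _] := @fund_circuitP _ _ hR (g |: B) e BR.
- by rewrite gN !in_setU1 eM !orbT.
- by rewrite in_setU1 negb_or eg.
set A' := A :|: [set f; g] in FR *.
have WR : sreorient A' W \in circuits (R A) by rewrite circuit_reorient sreorientK.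
have sWR : supp (sreorient A' W) \subset e |: (g |: B) by rewrite supp_reorient.
have dW := circuit_disjoint hN WN.
have gWs : g \in supp W by rewrite in_supp gW.
have FE : opposite_in (fund_circuit (R A) (g |: B) e) e g =
          opposite_in W e g (+) (e \in A') (+) (g \in A').
  rewrite -opposite_in_reorient //.
  by have [->|->] := fund_uniq hR BR FR WR sF sWR; rewrite ?opposite_in_opp.
have sFW : supp (fund_circuit (R A) (g |: B) e) = supp W.
  by rewrite -(supp_reorient A' W) (fund_uniq_supp hR BR FR WR sF sWR).
rewrite (@opposite_to_minE _ (ground N) le _ e g) //; first last.
- by apply: is_min_sub g_min _ _; rewrite sFW // (circuit_ground hN).
- by rewrite sFW (circuit_ground hN).
rewrite FE RA // in_setU in_set2 eqxx !orbT /opposite_in gW (disjointFr dW gW) andbF andbT.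
by case: (e \in A); case: (e \in W.2).
Qed.

(** The cocircuit of [contract N g] that defines [b \in O B] is, up to sign, the
    fundamental cocircuit of [b] for [g |: B] in [N]. It avoids [g], so its
    smallest element is [f]. *)
Lemma opposite_to_min_in A B b : A \subset ground M -> B \in bases M -> b \in B ->
  opposite_to_min le (fund_cocircuit (R A) (g |: B) b) b = ((b \in A) == (b \in O B)).
Proof.
move=> sA BM bB; have [fM gM] := fgM (subxx _).
have [fB gB] := fgM (basis_ground BM).
have bM := subsetP (basis_ground BM) b bB.
have BN : g |: B \in bases N by have := BM; rewrite basisE => /and3P[].
have BN1 := contract_basis BM.
have bB' : b \in g |: B by rewrite in_setU1 bB orbT.
have [Y YN1 [fY _ YB ->]] := orientation_sign_in hM ext1 lift1 BM bB.
have gY : g \notin supp Y.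
  by apply/negP => /(subsetP (cocircuit_ground YN1)); rewrite in_setD1 eqxx.
have YB' : supp Y :&: (g |: B) = [set b].
  rewrite -YB; apply/setP => x; rewrite !in_setI in_setU1.
  by have [->|] := eqVneq x g; rewrite // (negbTE gY).
have YN : Y \in cocircuits N.
  have [Y' Y'N [Y'B _]] := fund_cocircuit_exists hN BN bB'.
  have Y'N1 := contract_cocircuit hN g_ground gloop h1 BN1 Y'N bB Y'B.
  have Y'B1 : supp Y' :&: B = [set b].
    rewrite -Y'B; apply/setP => x; rewrite !in_setI in_setU1.
    have [->|//] := eqVneq x g; rewrite (negbTE gB) andbF /=.
    apply/esym/negP => /andP[gY' _]; have : g \in [set b] by rewrite -Y'B in_setI gY' setU11.
    by move/set1P => gb; rewrite gb bB in gB.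
  by have [->|->] := cocircuit_uniq h1 YN1 Y'N1 BN1 YB Y'B1; rewrite ?cocircuit_opp.
have hR : oriented_matroid (R A) by apply: reorient_oriented_matroid.
have BR : g |: B \in bases (R A) by rewrite bases_reorient.
have [FR FB _] := fund_cocircuitP hR BR bB'.
set A' := A :|: [set f; g] in FR *.
have YR : sreorient A' Y \in cocircuits (R A) by rewrite cocircuit_reorient sreorientK.
have YRB : supp (sreorient A' Y) :&: (g |: B) = [set b] by rewrite supp_reorient.
have dY := cocircuit_disjoint YN.
have fYs : f \in supp Y by rewrite in_supp fY.
have bYs : b \in supp Y by have := set11 b; rewrite -YB in_setI => /andP[].
have FE := cocircuit_uniq hR FR YR BR FB YRB.
have sFY : supp (fund_cocircuit (R A) (g |: B) b) = supp Y.
  by case: FE => ->; rewrite ?supp_opp supp_reorient.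
have sYg : supp Y \subset ground N :\ g by rewrite subsetD1 gY (cocircuit_ground YN).
rewrite (@opposite_to_minE _ (ground N) le _ b f) //; first last.
- by apply: is_min_sub f_min _ _; rewrite sFY.
- by rewrite sFY (cocircuit_ground YN).
have -> : opposite_in (fund_cocircuit (R A) (g |: B) b) b f =
          opposite_in Y b f (+) (b \in A') (+) (f \in A').
  by rewrite -opposite_in_reorient //; case: FE => ->; rewrite ?opposite_in_opp.
rewrite RA // in_setU in_set2 eqxx orbT /opposite_in fY (disjointFr dY fY) andbF andbT.
by case: (b \in A); case: (b \in Y.2).
Qed.

(** A cocircuit through [g] with the support prescribed by genericity contains
    [f], and compliance makes the signs at [f] and [g] equal. *)
Lemma compliant_cocircuit B : B \in bases M ->
  exists2 Z, Z \in cocircuits N &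
    supp Z = ground N :\: B /\ [\/ (f \in Z.1) && (g \in Z.1) | (f \in Z.2) && (g \in Z.2)].
Proof.
move=> BM; have [fM gM] := fgM (subxx _); have [fB gB] := fgM (basis_ground BM).
have [Z ZN sZ] := lift_new_cocircuit lift2 (contract_basis BM).
have {}sZ : supp Z = ground N :\: B.
  apply/setP => x; rewrite sZ in_setU1 !in_setD in_set1.
  by have [->|//] := eqVneq x g; rewrite gB g_ground.
exists Z => //; split=> //.
have fZ : f \in supp Z by rewrite sZ in_setD fB gN setU11.
have gZ : g \in supp Z by rewrite sZ in_setD gB g_ground.
have := cpl ZN; have := cpl (X := sopp Z); rewrite cocircuit_opp => /(_ ZN) /=.
move: fZ gZ; rewrite !in_supp => /orP[fZ|fZ] /orP[gZ|gZ]; rewrite fZ gZ //.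
- by left.
- by right.
Qed.

(** Both [f] and [g] are reoriented, so the claim is that they have opposite signs
    in the circuit of [N] on [f |: (g |: B)]. It meets the cocircuit of
    [compliant_cocircuit] in [f] and [g] only, where that one has equal signs. *)
Lemma opposite_to_min_f A B : A \subset ground M -> B \in bases M ->
  opposite_to_min le (fund_circuit (R A) (g |: B) f) f.
Proof.
move=> sA BM; have [fM gM] := fgM (subxx _); have [fB gB] := fgM (basis_ground BM).
have BN : g |: B \in bases N by have := BM; rewrite basisE => /and3P[].
have fB' : f \notin g |: B by rewrite in_setU1 negb_or hfg.
have BN2 : g |: B \in bases (delete N f) by rewrite (ext_basisE ext2) fB'.
have [X XN sX] := ext_new_circuit ext2 BN2.
have [Z ZN [sZ Zfg]] := compliant_cocircuit BM.
have dX := circuit_disjoint hN XN; have dZ := cocircuit_disjoint ZN.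
have [fX gX] : f \in supp X /\ g \in supp X by rewrite sX !in_setU1 !eqxx ?orbT.
have [fZ gZ] : f \in supp Z /\ g \in supp Z.
  by rewrite !in_supp; case: Zfg => /andP[-> ->]; rewrite ?orbT.
have sZX : supp Z :&: supp X \subset [set f; g].
  rewrite sZ sX; apply/subsetP => x; rewrite !inE => /andP[/andP[/negbTE-> _]].
  by rewrite orbF.
have Xfg : opposite_in X f g.
  have E := orthogonal_pairE dZ dX (cocircuit_orthogonal ZN XN) sZX fZ fX.
  move: E fX gX; rewrite /opposite_in /agree !in_supp /=.
  case: Zfg => /andP[f' g']; rewrite f' g'.
    rewrite (disjointFr dZ f') (disjointFr dZ g') /= !orbF => <-.
    by case: (g \in X.2); case: (f \in X.2); case: (g \in X.1).
  rewrite (disjointFl dZ f') (disjointFl dZ g') /= => <-.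
  by case: (g \in X.1); case: (f \in X.1); case: (g \in X.2).
have hR : oriented_matroid (R A) by apply: reorient_oriented_matroid.
have BR : g |: B \in bases (R A) by rewrite bases_reorient.
have [|//|FR sF _] := @fund_circuitP _ _ hR (g |: B) f BR.
  by rewrite gN setU11.
set A' := A :|: [set f; g] in FR *.
have XR : sreorient A' X \in circuits (R A) by rewrite circuit_reorient sreorientK.
have sXR : supp (sreorient A' X) \subset f |: (g |: B) by rewrite supp_reorient sX.
have FE := fund_uniq hR BR FR XR sF sXR.
have sFX : supp (fund_circuit (R A) (g |: B) f) = supp X.
  by case: FE => ->; rewrite ?supp_opp supp_reorient.
rewrite (@opposite_to_minE _ (ground N) le _ f g) //; first last.
- by apply: is_min_sub g_min _ _; rewrite sFX // (circuit_ground hN).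
- by rewrite sFX (circuit_ground hN).
have -> : opposite_in (fund_circuit (R A) (g |: B) f) f g = opposite_in (sreorient A' X) f g.
  by case: FE => ->; rewrite ?opposite_in_opp.
by rewrite opposite_in_reorient // Xfg !in_setU !in_set1 !eqxx ?orbT.
Qed.

Lemma fully_optimal_orientation A B : A \subset ground M -> B \in bases M ->
  fully_optimal (R A) g le (g |: B) = (A == O B).
Proof.
move=> sA BM; have [fM gM] := fgM (subxx _); have [fB gB] := fgM (basis_ground BM).
have BN : g |: B \in bases N by have := BM; rewrite basisE => /and3P[].
rewrite /fully_optimal bases_reorient BN /=.
have OE : (A == O B) = [forall x in ground M, (x \in A) == (x \in O B)].
  apply/eqP/forall_inP => [-> //|AO]; apply/setP => x.
  have [xM|xM] := boolP (x \in ground M); first exact/eqP/AO.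
  have /negbTE-> : x \notin A by apply: contra xM; apply: (subsetP sA).
  by rewrite inE (negbTE xM).
rewrite OE; apply/andP/forall_inP => [[/forall_inP out /forall_inP inn] x xM|AO].
  have [xB|xB] := boolP (x \in B).
    rewrite -opposite_to_min_in // inn // in_setD1 in_setU1 xB orbT andbT.
    by apply: contraNneq gB => <-.
  rewrite -opposite_to_min_out // out // in_setD in_setU1 negb_or xB gN !in_setU1 xM !orbT.
  by rewrite !andbT; apply: contraNneq gM => <-.
split; apply/forall_inP => x.
  rewrite in_setD in_setU1 negb_or gN !in_setU1 => /andP[/andP[/negbTE xg xB]].
  rewrite xg /= => /predU1P[->|xM]; first exact: opposite_to_min_f.
  by rewrite opposite_to_min_out ?AO.
rewrite in_setD1 in_setU1 => /andP[/negbTE-> /= xB].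
by rewrite opposite_to_min_in ?AO // (subsetP (basis_ground BM)).
Qed.

(** The element [g] cannot be opposite to itself in its own fundamental circuit,
    nor can [f] in its fundamental cocircuit. *)
Lemma fully_optimal_basis A S : fully_optimal (R A) g le S ->
  exists2 B, B \in bases M & S = g |: B.
Proof.
case/and3P => SR /forall_inP out /forall_inP inn.
have hR : oriented_matroid (R A) by apply: reorient_oriented_matroid.
have not_self F x : [disjoint F.1 & F.2] -> supp F \subset ground N ->
    is_min le (supp F) x -> opposite_to_min le F x = false.
  move=> dF sF mx; rewrite (opposite_to_minE _ le_order sF mx) /opposite_in andbC orbb.
  by apply/negP => /andP[x2]; rewrite (disjointFl dF x2).
have gS : g \in S.
  apply: contraT => gS; have := out g; rewrite in_setD gS g_ground => /(_ isT).
  have [FR _ gF] := fund_circuitP hR SR g_ground gS.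
  have sF := circuit_ground hR FR.
  rewrite not_self ?(circuit_disjoint hR) //.
  by apply: is_min_sub g_min sF _; rewrite in_supp gF.
have fS : f \notin S.
  apply/negP => fS; have := inn f; rewrite in_setD1 hfg fS => /(_ isT).
  have [FR FS fF] := fund_cocircuitP hR SR fS.
  have sF := cocircuit_ground FR.
  rewrite not_self ?(cocircuit_disjoint FR) //; apply: is_min_sub f_min _ _.
    rewrite subsetD1 sF; apply/negP => gF; have : g \in [set f] by rewrite -FS in_setI gF.
    by rewrite in_set1 eq_sym (negbTE hfg).
  by rewrite in_supp fF.
exists (S :\ g); last by rewrite setD1K.
rewrite basisE setD1K // in_setD1 (negbTE fS) andbF setD11 /=.
by rewrite bases_reorient in SR.
Qed.

(** After reorientation the complement of [B] supports a positive cocircuit [Z'],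
    which every circuit meets, so no circuit is positive. And the circuit (B, -f)
    of the reoriented [contract N g] lifts to a circuit [W] positive outside [g];
    a positive cocircuit avoiding [g] meets the basis [g |: B], hence [W], and
    would agree with [W] wherever they meet. *)
Lemma orientation_bounded B : B \in bases M -> bounded (R (O B)) g.
Proof.
move=> BM; have [fM gM] := fgM (subxx _); have [fB gB] := fgM (basis_ground BM).
have BN : g |: B \in bases N by have := BM; rewrite basisE => /and3P[].
have hR : oriented_matroid (R (O B)) by apply: reorient_oriented_matroid.
have BR : g |: B \in bases (R (O B)) by rewrite bases_reorient.
have sO := orientation_ground M (contract N g) (delete N f) f g B.
have [fO gO] := fgM sO.
set A := O B :|: [set f; g].
have OA x : x \in ground M -> (x \in A) = (x \in O B) by apply: RA.
have [fA gA] : f \in A /\ g \in A by rewrite !in_setU !in_set1 !eqxx ?orbT.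
have [Z ZN [sZ Zfg]] := compliant_cocircuit BM.
have fB' : f \notin g |: B by rewrite in_setU1 negb_or hfg.
have BN2 : g |: B \in bases (delete N f) by rewrite (ext_basisE ext2) fB'.
have dZ := cocircuit_disjoint ZN.
have sZB : supp Z :&: (g |: B) = [set g].
  apply/setP => x; rewrite sZ in_setI in_setD in_setU1 in_set1.
  have [->|_] := eqVneq x g; first by rewrite gB g_ground.
  by case: (x \in B); rewrite ?andbF.
(* Deleting f from Z leaves, up to sign, the cocircuit of delete N f that encodes
   O B; together with the equal signs at f and g this fixes Z. *)
have [Z' Z'R [Z'0 sZ']] : exists2 Z', Z' \in cocircuits (R (O B)) &
    Z'.2 = set0 /\ supp Z' = ground N :\: B.
  have := orientation_cocircuit hM ext1 lift1 BM; rewrite -/O.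
  set Q := sreorient (O B) _ => QN2.
  have sQ : supp Q = g |: (ground M :\: B).
    by rewrite supp_reorient /supp /= setUC.
  have QB : supp Q :&: (g |: B) = [set g].
    rewrite sQ; apply/setP => x; rewrite in_setI !in_setU1 in_setD in_set1.
    by case: (x == g) => //=; case: (x \in B); rewrite ?andbF.
  have ZN2 := delete_cocircuit h2 BN2 ZN sZB.
  have RZB : supp (srem f Z) :&: (g |: B) = [set g].
    rewrite supp_srem -[RHS]sZB; apply/setP => x; rewrite !in_setI in_setD1.
    by have [->|] := eqVneq x f; rewrite // (negbTE fB') !andbF.
  have [V [VN sV Vfg VQ]] : exists V, [/\ V \in cocircuits N, supp V = ground N :\: B,
     (f \in V.1) && (g \in V.1) \/ (f \in V.2) && (g \in V.2) & srem f V = Q].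
    have [E|E] := cocircuit_uniq h2 QN2 ZN2 BN2 QB RZB; first by exists Z.
    exists (sopp Z); rewrite cocircuit_opp supp_opp srem_opp -E; split=> //=.
    by case: Zfg; [right|left].
  have dV := cocircuit_disjoint VN.
  have Qg : g \in Q.2 by rewrite in_sreorient (negbTE gO) set11.
  have gV2 : g \in V.2 by move: Qg; rewrite -VQ /= in_setD1 eq_sym hfg.
  have fV2 : f \in V.2.
    by case: Vfg => /andP[//]; rewrite (disjointFl dV gV2).
  exists (sreorient A V); first by rewrite cocircuit_reorient sreorientK.
  rewrite supp_reorient; split=> //; apply/setP => x; rewrite in_set0 in_sreorient.
  have [->|xf] := eqVneq x f; first by rewrite fA (disjointFl dV fV2).
  have [->|xg] := eqVneq x g; first by rewrite gA (disjointFl dV gV2).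
  have VQx : ((x \in V.1) = (x \in Q.1)) * ((x \in V.2) = (x \in Q.2)).
    by rewrite -VQ !in_setD1 xf.
  rewrite !VQx !in_sreorient in_setU in_set2 (negbTE xf) (negbTE xg) !orbF.
  by case: (x \in O B); rewrite /= in_set1 (negbTE xg).
apply/andP; split; apply/forall_inP => X XR.
  apply/negP => /eqP X0.
  have /subsetPn[x xX xB] : ~~ (supp X \subset B).
    apply: contra (basis_indep BR XR) => sX; exact: subset_trans sX (subsetUr _ _).
  have xN := subsetP (circuit_ground hR XR) x xX.
  have x1 : x \in X.1 by move: xX; rewrite in_supp X0 in_set0 orbF.
  have xZ : x \in Z'.1.
    have : x \in supp Z' by rewrite sZ' in_setD xB.
    by rewrite in_supp Z'0 in_set0 orbF.
  have [||y] := @orthogonal_disagree _ Z' X x.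
  - exact: cocircuit_orthogonal Z'R XR.
  - by rewrite /agree xZ x1.
  by rewrite /agree /= X0 Z'0 !in_set0 andbF.
apply/implyP => /eqP X0; apply: contraT => gX.
have [x xX xB'] := cocircuit_meets XR BR.
have xB : x \in B.
  by move: xB'; rewrite in_setU1 => /predU1P[xg|//]; rewrite -xg xX in gX.
have xM := subsetP (basis_ground BM) x xB.
have x1 : x \in X.1 by move: xX; rewrite in_supp X0 in_set0 orbF.
have [W WN WE] := contract_circuit_lift (orientation_circuit hM ext1 lift1 BM).
have WR : sreorient A W \in circuits (R (O B)) by rewrite circuit_reorient sreorientK.
have W2 y : y != g -> y \notin (sreorient A W).2.
  move=> yg; rewrite in_sreorient.
  have E : ((y \in W.1) = (y \in (srem g W).1)) * ((y \in W.2) = (y \in (srem g W).2)).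
    by rewrite !in_setD1 yg.
  rewrite !E WE !in_sreorient in_setU in_set2 (negbTE yg) orbF.
  have [->|yf] := eqVneq y f; first by rewrite (negbTE fO) /= (negbTE fB).
  by case: (y \in O B) => /=; rewrite in_set1.
have W1 : x \in (sreorient A W).1.
  have xg : x != g by apply: contraNneq gM => <-.
  have : x \in supp (srem g W) by rewrite WE supp_reorient in_supp /= xB.
  rewrite supp_srem in_setD1 xg -(supp_reorient A) in_supp /= => /orP[//|].
  by rewrite (negbTE (W2 x xg)).
have [||y] := @orthogonal_disagree _ X (sreorient A W) x.
- exact: cocircuit_orthogonal XR WR.
- by rewrite /agree x1 W1.
move=> ay; have /andP[yX _] := agree_supp ay.
have yg : y != g by apply: contraNneq gX => <-.
by move: ay; rewrite /agree /= (negbTE (W2 y yg)) X0 in_set0 andbF.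
Qed.

End ExtensionLifting.

Lemma orientation_eq (T : finType) (M : omdata T) (hM : oriented_matroid M)
    (s1 s2 t1 t2 : {set T} -> signed T) :
  {in [set supp X | X in cocircuits M], s1 =1 s2} ->
  {in [set supp X | X in circuits M], t1 =1 t2} ->
  {in bases M, orientation_of_basis M s1 t1 =1 orientation_of_basis M s2 t2}.
Proof.
move=> hs ht B BM; apply/setP => x; rewrite !inE.
have [xM|//] := boolP (x \in ground M); have [xB|xB] := boolP (x \in B).
  by rewrite hs //; apply: imset_f; case: (fund_cocircuitP hM BM xB).
by rewrite ht //; apply: imset_f; case: (fund_circuitP hM BM xM xB).
Qed.

(** * Compatible reorientations, bases and fully optimal bases *)

Theorem theorem7 (T : finType) (M N' N'' : omdata T) (f g : T)
    (hM : oriented_matroid M) (hfg : f != g)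
    (hN' : generic_extension M N' f) (hN'' : generic_lifting M N'' g) :
  let sigmas := extension_signature M N' f in
  let sigma := lifting_signature M N'' g in
  let O := orientation_of_basis M sigmas sigma in
  let compat := compatible_reorientations M N' f N'' g in
  bijection_between (bases M) compat O /\
  forall (Mbar : omdata T) (le : rel T),
    generic_extension_lifting M Mbar f g ->
    given_by_signatures M Mbar f g sigmas sigma ->
    compliant Mbar f g ->
    linear_order_on (ground Mbar) le ->
    is_min le (ground Mbar) g ->
    is_min le (ground Mbar :\ g) f ->
    let N A := reorient [set f; g] (reorient A Mbar) in
    let basis_of A := alpha (N A) g le :\ g in
    [/\ {in compat, forall A, bounded (N A) g /\
           unique (fun B => fully_optimal (N A) g le B) (alpha (N A) g le)},
        bijection_between compat (bases M) basis_of,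
        {in bases M, cancel O basis_of} &
        {in compat, cancel basis_of O}].
Proof.
move=> sigmas sigma O compat.
have [injO imO] := orientation_bijection hM hN' hN''.
split; first by split.
move=> Mbar le [_ [hMb gMb] _ [ext2 lift2] [_ _ gloop _]] [ext1 sE lift1 tE] cpl.
move=> le_order g_min f_min N basis_of.
(* only signatures matter, so N' and N'' may be taken to be minors of Mbar *)
have OE := orientation_eq hM sE tE.
have [fM gM] := new_notin hN' hN'' (subxx (ground M)).
have compatP A : A \in compat -> exists2 B, B \in bases M & A = O B.
  by rewrite /compat -imO => /imsetP.
have NE (A : {set T}) : A \subset ground M -> N A = reorient (A :|: [set f; g]) Mbar.
  move=> sA; apply: reorient_reorient; rewrite disjoint_sym !disjoint_setU1l.
  rewrite (contra (subsetP sA f) fM) -(setU0 [set g]) disjoint_setU1l.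
  by rewrite (contra (subsetP sA g) gM) -setI_eq0 set0I eqxx.
have optimalE (A S : {set T}) : A \subset ground M -> fully_optimal (N A) g le S <->
    exists2 B, B \in bases M & S = g |: B /\ A = O B.
  move=> sA; rewrite NE //; split=> [opt|[B BM [-> AO]]].
    have [B BM SB] := fully_optimal_basis hMb hfg gMb gloop ext1 le_order g_min f_min opt.
    exists B => //; split=> //; move: opt; rewrite SB.
    rewrite (fully_optimal_orientation hM hMb hfg gMb gloop ext1 lift1 ext2 lift2) //.
    by rewrite OE // => /eqP.
  rewrite (fully_optimal_orientation hM hMb hfg gMb gloop ext1 lift1 ext2 lift2) //.
  by rewrite OE // AO.
have uniqB B : B \in bases M ->
    unique (fun S => fully_optimal (N (O B)) g le S) (g |: B).
  move=> BM; have sO := orientation_ground M N' N'' f g B.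
  split=> [|S /(optimalE _ _ sO)[B' B'M [-> /injO->//]]].
  by apply/(optimalE _ _ sO); exists B.
have alphaE B : B \in bases M -> alpha (N (O B)) g le = g |: B.
  move=> BM; have [opt uS] := uniqB B BM; rewrite /alpha.
  by case: pickP => [S /uS //|/(_ (g |: B))]; rewrite opt.
have OK : {in bases M, cancel O basis_of}.
  move=> B BM; rewrite /basis_of alphaE // setU1K //.
  by have [] := new_notin hN' hN'' (basis_ground BM).
have KO : {in compat, cancel basis_of O}.
  by move=> A /compatP[B BM ->]; rewrite OK.
split; [| |exact: OK|exact: KO].
- move=> A /compatP[B BM ->]; rewrite alphaE //; split; last exact: uniqB.
  rewrite (NE _ (orientation_ground M N' N'' f g B)) /O -OE //.
  exact: (orientation_bounded hM hMb hfg gMb gloop ext1 lift1 ext2 lift2 cpl BM).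
split; first exact: can_in_inj KO.
apply/setP => B; apply/imsetP/idP => [[A /compatP[B' B'M ->] ->]|BM]; first by rewrite OK.
by exists (O B); rewrite ?OK // /compat -imO imset_f.
Qed.
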